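(* Let $G_1$ and $G_2$ be two non-trivial countable amenable ICC groups and let $\Gamma = G_1 \times G_2$. Then there is a probability measure $\nu$ of full support on $\Gamma$ such that the Poisson–Furstenberg boundary $\partial(\Gamma,\nu)$ is non-trivial, $\Gamma$ acts essentially freely on $\partial(\Gamma,\nu)$, and the Poisson–Furstenberg boundaries $\partial(G_1,\mathrm{pr}_1(\nu))$ and $\partial(G_2,\mathrm{pr}_2(\nu))$ are trivial. Moreover, such a measure $\nu$ can be chosen to be symmetric (i.e. $\nu(g)=\nu(g^{-1})$ for all $g$).
   Context: A group is ICC (infinite conjugacy class) if every non-identity element has an infinite conjugacy class. For a countable group $G$ and a probability measure $\nu$ on $G$, the $\nu$-random walk is $Z_n = X_1\cdots X_n$ with $(X_i)$ i.i.d. of law $\nu$; the Poisson–Furstenberg boundary $\partial(G,\nu)$ is the space of ergodic components of the time-shift on the trajectory space $G^{\mathbb N}$ (equivalently, for non-degenerate $\nu$, the tail boundary), with the action of $G$ induced by left multiplication $g\cdot(\omega_1,\omega_2,\ldots)=(g\omega_1,g\omega_2,\ldots)$. The boundary is trivial if the corresponding $\sigma$-algebra is trivial mod 0. $\mathrm{pr}_j$ denotes the projection $G_1\times G_2\to G_j$, and $\mathrm{pr}_j(\nu)$ the pushforward measure. *)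

(* Defs.v *)
From HB Require Import structures.
From mathcomp Require Import all_boot all_order all_algebra.
From mathcomp Require Import all_classical all_reals all_analysis.

Set Implicit Arguments.
Unset Strict Implicit.
Unset Printing Implicit Defensive.

Import Order.TTheory GRing.Theory Num.Theory.
Local Open Scope classical_set_scope.
Local Open Scope ring_scope.

Record cgroup := CGroup {
  gcar :> countType;
  gmul : gcar -> gcar -> gcar;
  gone : gcar;
  ginv : gcar -> gcar;
  gmulA : forall x y z, gmul x (gmul y z) = gmul (gmul x y) z;
  gmul1 : forall x, gmul gone x = x;
  gmulV : forall x, gmul (ginv x) x = gone }.

Arguments gmul {c}.
Arguments gone {c}.
Arguments ginv {c}.

Section Product.
Variables G1 G2 : cgroup.

Definition pmul (x y : (gcar G1 * gcar G2)%type) : (gcar G1 * gcar G2)%type :=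
  (gmul x.1 y.1, gmul x.2 y.2).
Definition pone : (gcar G1 * gcar G2)%type := (gone, gone).
Definition pinv (x : (gcar G1 * gcar G2)%type) : (gcar G1 * gcar G2)%type :=
  (ginv x.1, ginv x.2).

Lemma pmulA x y z : pmul x (pmul y z) = pmul (pmul x y) z.
Proof. by case: x y z => [a b] [c d] [e f]; rewrite /pmul /= !gmulA. Qed.
Lemma pmul1 x : pmul pone x = x.
Proof. by case: x => a b; rewrite /pmul /= !gmul1. Qed.
Lemma pmulV x : pmul (pinv x) x = pone.
Proof. by case: x => a b; rewrite /pmul /= !gmulV. Qed.

Definition prod_cgroup : cgroup :=
  @CGroup (gcar G1 * gcar G2)%type pmul pone pinv pmulA pmul1 pmulV.
End Product.

Section GroupNotions.
Variable G : cgroup.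

Definition nontrivial_group : Prop := exists g : G, g <> gone.

Definition ICC : Prop :=
  forall g : G, g <> gone ->
    ~ finite_set [set x : G | exists h : G, x = gmul (gmul h g) (ginv h)].

(* Amenability of a countable discrete group, via the Foelner condition:
   for every finite F ⊆ G and every n > 0 there is a nonempty finite A
   (a duplicate-free list) with |gA Δ A| < |A|/n for all g in F.
   Here |gA \ A| = #{a in A | g a ∉ A} and |A \ gA| = #{a in A | g^-1 a ∉ A}. *)
Definition amenable : Prop :=
  forall (F : seq G) (n : nat), (0 < n)%N ->
    exists A : seq G, [/\ uniq A, A != [::] &
      forall g, g \in F ->
        (n * (count (fun a => gmul g a \notin A) A
              + count (fun a => gmul (ginv g) a \notin A) A) < size A)%N].
End GroupNotions.

Section Measures.
Variable R : realType.

Definition is_prob (G : cgroup) (nu : G -> R) : Prop :=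
  (forall g, 0 <= nu g) /\ (\esum_(g in [set: G]) (nu g)%:E = 1%E).

Definition full_support (G : cgroup) (nu : G -> R) : Prop :=
  forall g, 0 < nu g.

Definition symmetric_measure (G : cgroup) (nu : G -> R) : Prop :=
  forall g, nu (ginv g) = nu g.

Definition pr1_meas (G1 G2 : cgroup) (nu : prod_cgroup G1 G2 -> R) : G1 -> R :=
  fun a => fine (\esum_(b in [set: gcar G2]) (nu (a, b))%:E).
Definition pr2_meas (G1 G2 : cgroup) (nu : prod_cgroup G1 G2 -> R) : G2 -> R :=
  fun b => fine (\esum_(a in [set: gcar G1]) (nu (a, b))%:E).
End Measures.

#[non_forgetful_inheritance]
HB.instance Definition _ (G : cgroup) := isPointed.Build (gcar G) gone.
Notation paths G := (nat -> gcar G).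

Definition cylinders (G : cgroup) : set (set (paths G)) :=
  [set A | exists (n : nat) (g : G), A = [set w : paths G | w n = g]].

Notation Paths G := (g_sigma_algebraType (@cylinders G)).

Definition shift (G : cgroup) (w : Paths G) : Paths G := fun n => w n.+1.
Definition gact (G : cgroup) (g : G) (w : Paths G) : Paths G := fun n => gmul g (w n).

(* shift-invariant events: their sigma-algebra (mod 0) is the Poisson boundary *)
Definition invariant_event (G : cgroup) (A : set (Paths G)) : Prop :=
  measurable A /\ shift (G:=G) @^-1` A = A.

Section RandomWalk.
Variables (R : realType) (G : cgroup).

Definition increment (s : nat -> G) (i : nat) : G :=
  if i is j.+1 then gmul (ginv (s j)) (s i) else s 0%N.

(* P is the law of the trajectory (Z_1, Z_2, ...), Z_n = X_1 ... X_n,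
   (X_i) i.i.d. of law nu (coordinate w k is Z_{k+1}). *)
Definition rw_law (nu : G -> R) (P : probability (Paths G) R) : Prop :=
  forall (n : nat) (s : nat -> G),
    P [set w : Paths G | forall i, (i <= n)%N -> w i = s i]
    = (\prod_(i < n.+1) nu (increment s i))%:E.

Definition tail_trivial (P : probability (Paths G) R) : Prop :=
  forall A, invariant_event A -> P A = 0%E \/ P A = 1%E.

Definition poisson_trivial (nu : G -> R) : Prop :=
  forall P : probability (Paths G) R, rw_law nu P -> tail_trivial P.

Definition poisson_nontrivial (nu : G -> R) : Prop :=
  forall P : probability (Paths G) R, rw_law nu P -> ~ tail_trivial P.

(* G acts essentially freely on the boundary: for g <> 1, the fixed-point
   set of g is null, expressed in the boundary's measure algebra: every
   non-null boundary event A contains a non-null boundary event B with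
   B ∩ gB null. *)
Definition ess_free_boundary (nu : G -> R) : Prop :=
  forall P : probability (Paths G) R, rw_law nu P ->
  forall g : G, g <> gone ->
  forall A, invariant_event A -> (0 < P A)%E ->
    exists B, [/\ invariant_event B, B `<=` A, (0 < P B)%E &
                 P (B `&` (gact g @` B)) = 0%E].
End RandomWalk.

(* Main.v *)
Require Import Defs.
From HB Require Import structures.
From mathcomp Require Import all_boot all_order all_algebra.
From mathcomp Require Import all_classical all_reals all_analysis.
From mathcomp Require Import zify ring lra.

(* The walk reads letters of types t = 0, 1, 2, ...; a letter of type t is the pair
   (a psi(b,b') a'^-1, b phi(a,a') b'^-1) or its inverse, where a, a' and b, b' are
   uniform in very invariant Foelner subsets of G1 and G2.  In each coordinate
   separately a letter is uniform on an almost invariant set, so bounded harmonic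
   functions of one coordinate are constant and both marginal boundaries are
   trivial.  Jointly, psi and phi are chosen generic, which is possible since in an
   amenable ICC group centralizers have density zero: from u s v, with s of type t
   and u, v products of few letters of smaller type, one can read off u.

   The types have so heavy a tail that almost surely, at all late times, the
   largest type read so far is large compared with the time and occurs only once.
   Cutting the position at that letter again and again recovers an initial
   position y of the trajectory from its tail, and g y from the tail of the
   trajectory translated by g.  Hence g moves almost every boundary point, which
   is essential freeness; since the group is non-trivial, so is the boundary. *)

(** The obstacle is that a letter has to be decodable and invariant at once. If [u] can be read off
    [u s v], then the translates [u S] are pairwise disjoint, so [S] is far from invariant in the
    product, although both of its projections must be almost invariant. The crossed indices
    reconcile the two demands. With everything but the leading Foelner element frozen, a coordinate
    runs over a right translate of a Foelner set and is insensitive to left multiplication; yet the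
    generic middle part of the first coordinate betrays (b,b') and that of the second betrays
    (a,a'), so that only both coordinates together determine the letter. An inverse letter also
    begins with a Foelner element in each coordinate, so symmetry costs nothing.

    Full support forces the walk to read elements that are no letters. They are enumerated, treated
    as harmless below the current type, and made so unlikely beyond it that they fail to appear from
    some time on.

    Triviality of a marginal boundary is a statement on the probabilities of invariant events: as
    functions of the starting point they are harmonic, they lift to the product as functions of one
    coordinate, and there they are shown to be constant. *)

Set Implicit Arguments.
Unset Strict Implicit.
Unset Printing Implicit Defensive.

Import Order.TTheory GRing.Theory Num.Theory.

(** * Generic elements *)

Declare Scope cgroup_scope.
Delimit Scope cgroup_scope with cg.
Notation "x * y" := (gmul x y) : cgroup_scope.
Notation "x ^-1" := (ginv x) : cgroup_scope.
Notation "1" := gone : cgroup_scope.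

Section GroupLaws.
Local Open Scope cgroup_scope.
Variable G : cgroup.
Implicit Types x y z c : G.

Lemma gVK x y : x^-1 * (x * y) = y.
Proof. by rewrite gmulA gmulV gmul1. Qed.

Lemma gmulI x y z : x * y = x * z -> y = z.
Proof. by move=> /(congr1 (gmul x^-1)); rewrite !gVK. Qed.

Lemma gmulr1 x : x * 1 = x.
Proof. by apply: (@gmulI x^-1); rewrite gVK gmulV. Qed.

Lemma gmulrV x : x * x^-1 = 1.
Proof. by apply: (@gmulI x^-1); rewrite gVK gmulr1. Qed.

Lemma gKV x y : x * (x^-1 * y) = y.
Proof. by rewrite gmulA gmulrV gmul1. Qed.

Lemma gmulIr x y z : y * x = z * x -> y = z.
Proof.
by move=> /(congr1 (fun t => t * x^-1)); rewrite -!gmulA gmulrV !gmulr1.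
Qed.

Lemma ginvK x : x^-1^-1 = x.
Proof. by apply: (@gmulI x^-1); rewrite gmulV gmulrV. Qed.

Lemma ginv1 : (1 : G)^-1 = 1.
Proof. by apply: (@gmulI 1); rewrite gmulrV gmul1. Qed.

Lemma ginvM x y : (x * y)^-1 = y^-1 * x^-1.
Proof. by apply: (@gmulI (x * y)); rewrite gmulrV -gmulA gKV gmulrV. Qed.

Lemma ginv_inj x y : x^-1 = y^-1 -> x = y.
Proof. by move=> /(congr1 ginv); rewrite !ginvK. Qed.

Definition gE :=
  (ginvM, ginvK, ginv1, gVK, gKV, gmulV, gmulrV, gmul1, gmulr1).

Lemma gmul_eq1 x y : x * y = 1 -> x = y^-1.
Proof. by move=> h; apply: (@gmulIr y); rewrite h gmulV. Qed.

(** The word ball of radius [k] for the generators [E] and their inverses. Smallness conditions are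
    memberships in such balls, and [gballM] adds the radii. *)
Fixpoint gball (E : seq G) (k : nat) : seq G :=
  if k is k'.+1 then
    gball E k' ++ [seq x * y | x <- gball E k', y <- E ++ map ginv E]
  else [:: 1].

Lemma gball1 E k : 1 \in gball E k.
Proof. by elim: k => [|k IH] /=; rewrite ?inE// mem_cat IH. Qed.

Lemma sub_gball E k l : (k <= l)%N -> {subset gball E k <= gball E l}.
Proof.
move=> /subnK <-; elim: (l - k)%N => // m IH x xk.
by rewrite addSn /= mem_cat IH.
Qed.

Lemma gballS E k x y : x \in gball E k -> y \in E ++ map ginv E ->
  x * y \in gball E k.+1.
Proof.
by move=> xk yE; rewrite /= mem_cat; apply/orP; right; apply: allpairs_f.
Qed.

Lemma gballM E k l x y : x \in gball E k -> y \in gball E l ->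
  x * y \in gball E (k + l).
Proof.
elim: l y => [|l IH] y xk /=; first by rewrite inE => /eqP ->; rewrite gmulr1 addn0.
rewrite addnS mem_cat => /orP[yl|/allpairsP[[p q] /= [pl qE ->]]].
  by rewrite mem_cat IH.
by rewrite gmulA; apply: gballS; rewrite ?IH.
Qed.

Lemma gball_mem E k x : (0 < k)%N -> x \in E -> x \in gball E k.
Proof.
move=> k0 xE; apply: (sub_gball k0).
by rewrite -[x]gmul1; apply: gballS; rewrite ?gball1// mem_cat xE.
Qed.

Lemma gballV E k x : x \in gball E k -> x^-1 \in gball E k.
Proof.
elim: k x => [|k IH] x /=; first by rewrite !inE => /eqP ->; rewrite ginv1.
rewrite mem_cat => /orP[xk|/allpairsP[[p q] /= [pk qE ->]]].
  by rewrite mem_cat IH.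
rewrite -/(gball E k.+1) ginvM -[k.+1]add1n; apply: gballM; last exact: IH.
rewrite -[_^-1]gmul1; apply: gballS; rewrite ?gball1// mem_cat.
move: qE; rewrite mem_cat => /orP[qE|/mapP[r rE ->]].
  by rewrite map_f ?orbT.
by rewrite ginvK rE.
Qed.

End GroupLaws.
Arguments gball : simpl never.
Arguments gmul : simpl never.
Arguments ginv : simpl never.
Arguments gone : simpl never.

Ltac gsimp := rewrite ?ginvM ?ginvK ?ginv1 -?gmulA ?gE.


Section Generic.
Local Open Scope cgroup_scope.
Variable G : cgroup.
Hypotheses (nt : nontrivial_group G) (am : amenable G) (icc : ICC G).
Implicit Types x y c t : G.

Lemma many_conjugates y (N : nat) : y <> 1 ->
  exists T : seq G, size T = N /\ uniq [seq t * y * t^-1 | t <- T].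
Proof.
move=> y1; elim: N => [|N [T [sT uT]]]; first by exists [::].
have [t tP] : exists t, t * y * t^-1 \notin [seq t * y * t^-1 | t <- T].
  apply: contrapT => h; apply: (icc y1).
  apply: (@sub_finite_set _ _ [set` [seq t * y * t^-1 | t <- T]]).
    by move=> x /= [t ->]; apply: contrapT => /negP ht; apply: h; exists t.
  exact: finite_seq.
by exists (t :: T); rewrite /= sT tP uT.
Qed.

(* A left translate of [{c | c x c^-1 = y}] by [t] is [{c | c x c^-1 = t y t^-1}];
   as [y] has infinitely many conjugates, these sets have density zero. *)
Lemma conj_sparse (Q : seq (G * G)) :
  (forall p, p \in Q -> p.2 <> 1) ->
  exists c, forall p, p \in Q -> c * p.1 * c^-1 <> p.2.
Proof.
move=> Q1.
(* Each bad set will fill at most the fraction 2 / [N] of a Foelner set: 1 / [N] from [N] disjoint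
   translates and 1 / [N] from the Foelner error. With this [N] the [size Q] bad sets cannot cover
   it. *)
pose N := (2 * size Q).+1.
have /choice[T TP] : forall y : G, exists T : seq G, y <> 1 ->
    size T = N /\ uniq [seq t * y * t^-1 | t <- T].
  move=> y; have [y1|y1] := pselect (y = 1); first by exists [::].
  by have [T TP] := many_conjugates N y1; exists T.
have [A [uA A0 AF]] := am (flatten [seq T p.2 | p <- Q]) (ltn0Sn _ : (0 < N)%N).
pose q (z x : G) := fun c => c * x * c^-1 == z.
have cnt p : p \in Q ->
    (N * count (q p.2 p.1) A <= 2 * size A)%N.
  move=> pQ; have [sT uT] := TP _ (Q1 _ pQ).
  have le1 : (\sum_(t <- T p.2) count (q (t * p.2 * t^-1)%cg p.1) A <= size A)%N.
    under eq_bigr do rewrite -sum1_count big_mkcond /=.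
    rewrite exchange_big /= -sum1_size; apply: leq_sum => c _.
    rewrite -big_mkcond /= sum1_count.
    rewrite -(count_map (fun t => t * p.2 * t^-1) (fun z => c * p.1 * c^-1 == z)).
    rewrite (eq_count (a2 := pred1 (c * p.1 * c^-1))); last first.
      by move=> z; rewrite /= eq_sym.
    by rewrite count_uniq_mem// leq_b1.
  have le2 t : t \in T p.2 ->
      (count (q p.2 p.1) A <= count (q (t * p.2 * t^-1)%cg p.1) A +
         count (fun a => (t * a)%cg \notin A) A)%N.
    move=> tT.
    rewrite -size_filter -(count_predC (fun a => (t * a)%cg \in A)) count_filter.
    rewrite leq_add//; last first.
      by rewrite count_filter; apply: sub_count => c /= /andP[].
    rewrite -!size_filter -(size_map (gmul t)).
    apply: uniq_leq_size.
      by rewrite map_inj_uniq ?filter_uniq// => x y; exact: gmulI.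
    move=> z /mapP[c]; rewrite !mem_filter /= => /andP[/andP[tcA /eqP qc] cA] ->.
    by rewrite tcA andbT /q -qc; apply/eqP; gsimp.
  have le3 : (N * count (q p.2 p.1) A <=
     \sum_(t <- T p.2) (count (q (t * p.2 * t^-1)%cg p.1) A +
         count (fun a => (t * a)%cg \notin A) A))%N.
    rewrite -sT -sum1_size big_distrl /= big_seq [X in (_ <= X)%N]big_seq.
    by apply: leq_sum => t tT; rewrite mul1n le2.
  have le4 : (\sum_(t <- T p.2) count (fun a => (t * a)%cg \notin A) A <= size A)%N.
    rewrite -(leq_pmul2l (ltn0Sn _ : 0 < N)%N) -{2}sT -[size (T _)]sum1_size.
    rewrite big_distrl big_distrr /= big_seq [X in (_ <= X)%N]big_seq.
    apply: leq_sum => t tT; rewrite mul1n.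
    have tF : t \in flatten [seq T p.2 | p <- Q].
      by apply/flattenP; exists (T p.2) => //; apply/mapP; exists p.
    apply: ltnW; apply: leq_ltn_trans (AF t tF).
    by rewrite leq_mul2l leq_addr orbT.
  by apply: leq_trans le3 _; rewrite big_split mul2n -addnn leq_add.
apply: contrapT => h.
have /allP cov : all (fun c => has (fun p => c * p.1 * c^-1 == p.2) Q) A.
  apply/allP => c cA; apply: contrapT => /negP /hasPn hc; apply: h.
  by exists c => p pQ; apply/eqP; exact: hc.
have : (size A <= \sum_(p <- Q) count (q p.2 p.1) A)%N.
  under eq_bigr do rewrite -sum1_count big_mkcond /=.
  rewrite exchange_big /= -sum1_size big_seq [X in (_ <= X)%N]big_seq.
  by apply: leq_sum => c cA; rewrite -big_mkcond /= sum1_count -has_count; exact: cov.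
rewrite -(leq_pmul2l (ltn0Sn _ : 0 < N)%N) big_distrr /= => le5.
have : (N * size A <= size Q * (2 * size A))%N.
  apply: leq_trans le5 _; rewrite -[size Q]sum1_size big_distrl /=.
  rewrite big_seq [X in (_ <= X)%N]big_seq; apply: leq_sum => p pQ.
  by rewrite mul1n cnt.
have : (0 < size A)%N by rewrite lt0n size_eq0.
rewrite /N; nia.
Qed.

(* If [c x c = y] with [c] conjugating no element of a large ball into that ball,
   then [y = x^-1], so [c x] is an involution.  If this happens for [c] and for
   [c t], the two involutions conjugate [x^-1 t x'] to its inverse, which is
   excluded for [t] outside [E E^-1]; hence [c] or [c t] is generic. *)
Lemma generic_element (E : seq G) : exists c,
  [/\ forall x y, x \in E -> y \in E -> c * x * c^-1 = y -> x = 1,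
      c \notin E &
      forall x y, x \in E -> y \in E -> c * x * c <> y].
Proof.
have [g0 g01] := nt.
have conj1 c x y : c * x * c^-1 = y -> y = 1 -> x = 1.
  move=> <- h; apply: (@gmulI _ c); apply: (@gmulIr _ c^-1).
  by rewrite h; gsimp.
(* An element [t] that conjugates [g0] to none of the e g0 e^-1 with e in the ball is different from
   all these e. *)
have [t tP] : exists t, t \notin gball E 2.
  have [p|t tP] := @conj_sparse [seq (g0, e * g0 * e^-1) | e <- gball E 2].
    by move=> /mapP[e _ ->] /= /conj1 h; apply: g01; apply: h.
  exists t; apply/negP => tE.
  by apply: (tP (g0, t * g0 * t^-1)) => //; apply/mapP; exists t.
(* [t] is a generator because conjugation by [c * t] is reduced to conjugation by [c]. [g0] is one
   because it keeps [c] and [c * t] out of [E]: an element of [E] would conjugate [g0], or a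
   conjugate of it, inside the ball. *)
pose B := gball (t :: g0 :: E) 8.
have BE x k : (0 < k)%N -> x \in E -> x \in gball (t :: g0 :: E) k.
  by move=> k0 xE; apply: gball_mem => //; rewrite !inE xE !orbT.
have Bt : t \in gball (t :: g0 :: E) 1 by apply: gball_mem; rewrite // inE eqxx.
have Bg : g0 \in gball (t :: g0 :: E) 1.
  by apply: gball_mem; rewrite // !inE eqxx orbT.
have [p|c cP] := @conj_sparse [seq p <- [seq (x, y) | x <- B, y <- B] | p.2 != 1].
  by rewrite mem_filter => /andP[/eqP].
have {}cP x y : x \in B -> y \in B -> c * x * c^-1 = y -> y = 1.
  move=> xB yB h; apply: contrapT => /eqP y1; apply: (cP (x, y)) => //.
  by rewrite mem_filter; apply/andP; split=> //; apply/allpairsP; exists (x, y).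
have BE1 x : x \in E -> x \in gball (t :: g0 :: E) 1 by exact: BE.
have BB k x : (k <= 8)%N -> x \in gball (t :: g0 :: E) k -> x \in B.
  by move=> k8; exact: sub_gball.
have P1 x y : x \in E -> y \in E -> c * x * c^-1 = y -> x = 1.
  move=> xE yE h; apply: (conj1 _ _ _ h).
  by apply: cP h; apply: (@BB 1%N); rewrite ?BE1.
have P1t x y : x \in E -> y \in E -> (c * t) * x * (c * t)^-1 = y -> x = 1.
  move=> xE yE h; apply: (conj1 _ _ _ h).
  apply: (cP (t * x * t^-1)); first last.
  - by rewrite -h; gsimp.
  - by apply: (@BB 1%N); rewrite ?BE1.
  apply: (@BB (1 + 1 + 1)%N) => //.
  by apply: gballM; [apply: gballM => //; exact: BE1 | exact: gballV].
have P2 : c \notin E.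
  apply/negP => cE; apply: g01; apply: (conj1 c _ (c * g0 * c^-1)) => //.
  apply: (cP g0) => //; first exact: (@BB 1%N).
  apply: (@BB (1 + 1 + 1)%N) => //; have cB := BE1 _ cE.
  by apply: gballM; [apply: gballM | exact: gballV].
have P2t : c * t \notin E.
  apply/negP => cE; apply: g01.
  apply: (conj1 (c * t) _ ((c * t) * g0 * (c * t)^-1)) => //.
  have cB := BE1 _ cE.
  apply: (cP (t * g0 * t^-1)); last by gsimp.
    apply: (@BB (1 + 1 + 1)%N) => //.
    by apply: gballM; [apply: gballM | exact: gballV].
  apply: (@BB (1 + 1 + 1)%N) => //.
  by apply: gballM; [apply: gballM | exact: gballV].
have [P3|] := pselect (forall x y, x \in E -> y \in E -> c * x * c <> y).
  by exists c.
move=> nP3; exists (c * t); split => // x' y' x'E y'E h'; apply: nP3.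
move=> x y xE yE h.
have yx : y * x = 1.
  apply: (cP (x * y)); last by rewrite -h; gsimp.
    by apply: (@BB (1 + 1)%N) => //; apply: gballM; exact: BE1.
  by apply: (@BB (1 + 1)%N) => //; apply: gballM; exact: BE1.
have yx' : y' * x' = 1.
  apply: (cP (t * (x' * y') * t^-1)); last by rewrite -h'; gsimp.
    apply: (@BB (1 + (1 + 1) + 1)%N) => //; apply: gballM; last exact: gballV.
    by apply: gballM => //; apply: gballM; exact: BE1.
  by apply: (@BB (1 + 1)%N) => //; apply: gballM; exact: BE1.
have {}yx := gmul_eq1 yx; have {}yx' := gmul_eq1 yx'.
have xt : x'^-1 * t^-1 * x = 1.
  apply: (cP (t * x' * x^-1)).
  - apply: (@BB (1 + 1 + 1)%N) => //; apply: gballM; last by apply/gballV/BE1.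
    by apply: gballM => //; exact: BE1.
  - apply: (@BB (1 + 1 + 1)%N) => //; apply: gballM; last exact: BE1.
    by apply: gballM; apply: gballV => //; exact: BE1.
  have -> : x^-1 = c * x * c by rewrite h yx.
  have -> : x'^-1 = c * t * x' * (c * t) by rewrite h' yx'.
  by gsimp.
move: tP => /negP; apply.
have -> : t = x * x'^-1.
  have xt' := congr1 (fun z => t * x' * z * x'^-1) xt.
  by move: xt'; gsimp => <-.
by apply: (@gballM _ _ 1 1); [|apply: gballV]; apply: gball_mem.
Qed.

(** The values are chosen one after the other, each generic for the ball of radius 3 over [E] and
    the earlier values. The three clauses will serve to compare two letters, a letter with an
    inverse letter, and a letter with a short word. *)
Lemma generic_family (J : eqType) (I : seq J) (E : seq G) :
  exists psi : J -> G, forall p q x y, p \in I -> q \in I ->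
    x \in E -> y \in E ->
    [/\ x * psi p * y = psi q -> [/\ p = q, x = 1 & y = 1],
        x * psi p * y * psi q <> 1 & x * psi p * y <> 1].
Proof.
elim: I => [|p0 I [psi psiP]]; first by exists (fun=> 1).
have [p0I|p0I] := boolP (p0 \in I).
  exists psi => p q x y; rewrite !inE.
  by move=> /orP[/eqP ->|pI] /orP[/eqP ->|qI]; exact: psiP.
pose E' := gball (E ++ map psi I) 3.
have [c [c1 c2 c3]] := generic_element E'.
exists (fun p => if p == p0 then c else psi p).
have E1 x : x \in E -> x \in gball (E ++ map psi I) 1.
  by move=> xE; apply: gball_mem; rewrite // mem_cat xE.
have E2 x : x \in E -> x \in E'.
  by move=> /E1; exact: sub_gball.
have I1 p : p \in I -> psi p \in gball (E ++ map psi I) 1.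
  by move=> pI; apply: gball_mem; rewrite // mem_cat map_f ?orbT.
have np p : p \in I -> (p == p0) = false.
  by move=> pI; apply: contraNF p0I => /eqP <-.
have E3 x y p : x \in E -> y \in E -> p \in I -> x * psi p * y \in E'.
  by move=> xE yE pI; apply: (@gballM _ _ 2 1); [apply: (@gballM _ _ 1 1); auto|auto].
have nc z : z \in E' -> c = z -> False by move=> zE ez; move: c2; rewrite ez zE.
have V z : z \in E' -> z^-1 \in E' by exact: gballV.
have E1V x : x \in E -> x^-1 \in gball (E ++ map psi I) 1.
  by move=> xE; apply: gballV; exact: E1.
move=> p q x y; rewrite !inE.
move=> /orP[/eqP ->|pI] /orP[/eqP ->|qI] xE yE; rewrite ?eqxx ?np//; last exact: psiP.
- split.
  + move=> h; have y1 : y = 1.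
      apply: (c1 y x^-1); [exact: E2|by apply/V/E2|].
      by rewrite -{2}h; gsimp.
    split => //; apply: (@gmulIr _ c); rewrite gmul1.
    by rewrite -{2}h y1 gmulr1.
  + move=> h; apply: (c3 y x^-1); [exact: E2|by apply/V/E2|].
    by apply: (@gmulI _ x); rewrite gmulrV -h !gmulA.
  + move=> h; apply: (@nc (x^-1 * y^-1)).
      apply: (@sub_gball _ _ 2) => //.
      by apply: (@gballM _ _ 1 1); exact: E1V.
    by apply: (@gmulI _ x); apply: (@gmulIr _ y); rewrite h; gsimp.
- split.
  + move=> h; exfalso; apply: (@nc (x^-1 * psi q * y^-1)).
      by apply: (@gballM _ _ 2 1); [apply: (@gballM _ _ 1 1); auto|auto].
    by rewrite -h; gsimp.
  + move=> h; apply: (@nc (x^-1 * (psi q)^-1 * y^-1)).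
      apply: (@gballM _ _ 2 1); [apply: (@gballM _ _ 1 1)|]; auto.
      by apply: gballV; auto.
    have {}h := gmul_eq1 h.
    by rewrite -h; gsimp.
  + move=> h; apply: (@nc (x^-1 * y^-1)).
      apply: (@sub_gball _ _ 2) => //.
      by apply: (@gballM _ _ 1 1); exact: E1V.
    by apply: (@gmulI _ x); apply: (@gmulIr _ y); rewrite h; gsimp.
- split.
  + by move=> h; exfalso; apply: (@nc (x * psi p * y)) => //; exact: E3.
  + move=> h; apply: (@nc (x * psi p * y)^-1); first by apply: V; exact: E3.
    by apply: (@gmulI _ (x * psi p * y)); rewrite h; gsimp.
  + by have [] := psiP p p x y pI pI xE yE.
Qed.

End Generic.

(** * Letters *)

Section AlmostInvariance.
Local Open Scope ring_scope.
Variable R : realType.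

Lemma ler_sum_sub (T : eqType) (s A : seq T) (f : T -> R) :
  uniq s -> uniq A -> {subset s <= A} -> (forall x, 0 <= f x) ->
  \sum_(x <- s) f x <= \sum_(x <- A) f x.
Proof.
move=> us uA sA f0.
have /(perm_big _) -> /= : perm_eq s [seq x <- A | x \in s].
  apply: uniq_perm => //; first exact: filter_uniq.
  by move=> x; rewrite mem_filter; case: (boolP (x \in s)) => //= /sA ->.
rewrite big_filter [X in _ <= X](bigID (mem s)) /= lerDl.
exact: sumr_ge0.
Qed.

Lemma Foelner_sum (G : cgroup) (A : seq G) (n : nat) (g : G) (f : G -> R) :
  uniq A -> (n * count (fun a => gmul g a \notin A) A <= size A)%N ->
  (forall x, 0 <= f x <= 1) ->
  n%:R * \sum_(a <- A) f (gmul g a) <= n%:R * \sum_(a <- A) f a + (size A)%:R.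
Proof.
move=> uA Ag f01.
set c := count _ A in Ag.
have h : \sum_(a <- A) f (gmul g a) <= \sum_(a <- A) f a + c%:R.
  rewrite (bigID (fun a => gmul g a \in A)) /= lerD//.
    rewrite -big_filter -(big_map (gmul g) xpredT f); apply: ler_sum_sub => //.
    - by rewrite map_inj_uniq ?filter_uniq// => x y; exact: gmulI.
    - by move=> x /mapP[y]; rewrite mem_filter => /andP[yA _] ->.
    - by move=> x; case/andP: (f01 x).
  rewrite /c -sum1_count natr_sum; apply: ler_sum => a _.
  by case/andP: (f01 (gmul g a)).
apply: le_trans (_ : n%:R * (\sum_(a <- A) f a + c%:R) <= _).
  by rewrite ler_wpM2l.
by rewrite mulrDr lerD2l -natrM ler_nat.
Qed.

Lemma Foelner_family (G : cgroup) (I : Type) (r : seq I) (A : seq G) (n : nat)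
    (g : G) (f : I -> G -> R) :
  uniq A -> (n * count (fun a => gmul g a \notin A) A <= size A)%N ->
  (forall i x, 0 <= f i x <= 1) ->
  n%:R * \sum_(i <- r) \sum_(a <- A) f i (gmul g a) <=
  n%:R * \sum_(i <- r) \sum_(a <- A) f i a + (size r * size A)%:R.
Proof.
move=> uA Ag f01; elim: r => [|i r IH]; first by rewrite !big_nil mulr0 addr0.
rewrite !big_cons !mulrDr /= mulSn natrD.
have := Foelner_sum uA Ag (f01 i); lra.
Qed.

(** One inequality is enough: the reverse one comes from applying it to a translate of [H] and to
    the inverse of [g]. *)
Definition almost_invariant (G : cgroup) (n : nat) (F S : seq G) (H : G -> R) :=
  forall g, g \in F ->
    n%:R * \sum_(x <- S) H (gmul g x) <= n%:R * \sum_(x <- S) H x + (size S)%:R.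
End AlmostInvariance.

(** * Decodable sets with almost invariant projections *)

Section Switching.

Local Open Scope cgroup_scope.

Lemma gball_sandwichV (G : cgroup) (E : seq G) (a g a' : G) :
  a \in gball E 1 -> g \in gball E 2 -> a' \in gball E 1 ->
  a^-1 * g * a' \in gball E 4.
Proof.
move=> aE gE aE'; apply: (@gballM _ _ 3 1) => //.
by apply: (@gballM _ _ 1 2) => //; exact: gballV.
Qed.

(** The last clause ensures that a product containing a letter is never mistaken for a short word;
    it also makes letters of different types distinct. *)
Definition switching (G : cgroup) (F S : seq G) :=
  [/\ uniq S, S != [::], forall s, s \in S -> s^-1 \in S,
   forall u v u' v' s s', u \in F -> v \in F -> u' \in F -> v' \in F ->
     s \in S -> s' \in S -> u * s * v = u' * s' * v' -> u = u' &
   forall u v s, u \in F -> v \in F -> s \in S -> u * s * v \notin F].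

Definition coordinate_fun (R : realType) (G1 G2 : cgroup)
    (H : prod_cgroup G1 G2 -> R) :=
  (exists f : G1 -> R, forall x, H x = f x.1) \/
  (exists f : G2 -> R, forall x, H x = f x.2).

Variable R : realType.
Variables G1 G2 : cgroup.
Hypotheses (nt1 : nontrivial_group G1) (nt2 : nontrivial_group G2).
Hypotheses (am1 : amenable G1) (am2 : amenable G2).
Hypotheses (icc1 : ICC G1) (icc2 : ICC G2).
Let G := prod_cgroup G1 G2.

Lemma switching_exists (F : seq G) (n : nat) : (0 < n)%N ->
  exists S : seq G, switching F S /\
    forall H : G -> R, coordinate_fun H -> (forall x, (0 <= H x <= 1)%R) ->
    almost_invariant n F S H.
Proof.
move=> n0.
have [A [uA A0 AF]] := am1 (map fst F) n0.
have [B [uB B0 BF]] := am2 (map snd F) n0.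
pose AA := [seq (a, a') | a <- A, a' <- A].
pose BB := [seq (b, b') | b <- B, b' <- B].
pose E1 := map fst F ++ A; pose E2 := map snd F ++ B.
(* Radius 4: comparing two letters leaves factors x^-1 g y with x and y in the Foelner set and g a
   quotient of two elements of [F]. *)
have [psi psiP] := generic_family nt1 am1 icc1 BB (gball E1 4).
have [phi phiP] := generic_family nt2 am2 icc2 AA (gball E2 4).
(* Each coordinate starts and, in the inverse, ends with a uniform element of a
   Foelner set.  As [psi] and [phi] are chosen after [A] and [B], the first
   coordinate of [g * sp d * g'] determines [d.2] and then the second one [d.1]. *)
pose sp (d : (G1 * G1) * (G2 * G2)) : G :=
  (d.1.1 * psi d.2 * d.1.2^-1, d.2.1 * phi d.1 * d.2.2^-1).
pose D := [seq (p, q) | p <- AA, q <- BB].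
have AAP p : p \in AA -> p.1 \in gball E1 1 /\ p.2 \in gball E1 1.
  by move=> /allpairsP[[a a'] /= [aA a'A ->]] /=; split; apply: gball_mem;
    rewrite // mem_cat ?aA ?a'A orbT.
have BBP p : p \in BB -> p.1 \in gball E2 1 /\ p.2 \in gball E2 1.
  by move=> /allpairsP[[a a'] /= [aA a'A ->]] /=; split; apply: gball_mem;
    rewrite // mem_cat ?aA ?a'A orbT.
pose small (g : G) := g.1 \in gball E1 2 /\ g.2 \in gball E2 2.
(* [K], [M] and [N] transport the three clauses of [generic_family] to letters. Only [K] needs both
   coordinates; for [M] and [N] the first one already gives a contradiction. *)
have K p q p' q' g g' : p \in AA -> p' \in AA -> q \in BB -> q' \in BB ->
    small g -> small g' -> g * sp (p, q) * g' = sp (p', q') ->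
    [/\ p = p', q = q' & g = 1].
  move=> pA pA' qB qB' [g1 g2] [g1' g2'] [].
  have [? ?] := AAP _ pA; have [? ?] := AAP _ pA'.
  have [? ?] := BBP _ qB; have [? ?] := BBP _ qB'.
  rewrite /sp /= => h1 h2.
  have X1 : p'.1^-1 * g.1 * p.1 \in gball E1 4 by exact: gball_sandwichV.
  have Y1 : p.2^-1 * g'.1 * p'.2 \in gball E1 4 by exact: gball_sandwichV.
  have X2 : q'.1^-1 * g.2 * q.1 \in gball E2 4 by exact: gball_sandwichV.
  have Y2 : q.2^-1 * g'.2 * q'.2 \in gball E2 4 by exact: gball_sandwichV.
  have [+ _ _] := psiP _ _ _ _ qB qB' X1 Y1; case=> [|qq x1 _].
    by apply: (@gmulI _ p'.1); apply: (@gmulIr _ p'.2^-1); move: h1; gsimp.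
  have [+ _ _] := phiP _ _ _ _ pA pA' X2 Y2; case=> [|pp x2 _].
    by apply: (@gmulI _ q'.1); apply: (@gmulIr _ q'.2^-1); move: h2; gsimp.
  split=> //; move: x1 x2; rewrite -pp -qq => x1 x2.
  rewrite [g]surjective_pairing; congr (_, _).
    apply: (@gmulI _ p.1^-1); apply: (@gmulIr _ p.1).
    by rewrite x1; gsimp.
  apply: (@gmulI _ q.1^-1); apply: (@gmulIr _ q.1).
  by rewrite x2; gsimp.
have M p q p' q' g g' : p \in AA -> p' \in AA -> q \in BB -> q' \in BB ->
    small g -> small g' -> g * sp (p, q) * g' * sp (p', q') <> 1.
  move=> pA pA' qB qB' [g1 g2] [g1' g2'] [].
  have [? ?] := AAP _ pA; have [? ?] := AAP _ pA'.
  rewrite /sp /= => h1 _.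
  have [? ?] := AAP _ pA'.
  have X1 : p'.2^-1 * g.1 * p.1 \in gball E1 4 by exact: gball_sandwichV.
  have Y1 : p.2^-1 * g'.1 * p'.1 \in gball E1 4 by exact: gball_sandwichV.
  have [_ + _] := psiP _ _ _ _ qB qB' X1 Y1.
  apply; apply: (@gmulI _ p'.2); apply: (@gmulIr _ p'.2^-1).
  by move: h1; gsimp => ->.
have N p q g g' : p \in AA -> q \in BB ->
    small g -> small g' -> g * sp (p, q) * g' <> 1.
  move=> pA qB [g1 g2] [g1' g2'] [].
  have [? ?] := AAP _ pA.
  rewrite /sp /= => h1 _.
  have X1 : 1^-1 * g.1 * p.1 \in gball E1 4.
    by apply: gball_sandwichV => //; exact: gball1.
  have Y1 : p.2^-1 * g'.1 * 1 \in gball E1 4.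
    by apply: gball_sandwichV => //; exact: gball1.
  have [_ _ +] := psiP _ _ _ _ qB qB X1 Y1.
  by apply; move: h1; gsimp.
have DP d : d \in D -> d.1 \in AA /\ d.2 \in BB.
  by move=> /allpairsP[[p q] /= [pA qB ->]].
have smF u v : u \in F -> v \in F ->
    [/\ small (u^-1 * v), small (u * v^-1) & small v].
  move=> uF vF.
  have g1 (w : G) : w \in F -> w.1 \in gball E1 1.
    by move=> wF; apply: gball_mem => //; rewrite mem_cat map_f.
  have g2 (w : G) : w \in F -> w.2 \in gball E2 1.
    by move=> wF; apply: gball_mem => //; rewrite mem_cat map_f.
  split; split; rewrite /=.
  - by apply: (@gballM _ _ 1 1); [apply: gballV|]; apply: g1.
  - by apply: (@gballM _ _ 1 1); [apply: gballV|]; apply: g2.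
  - by apply: (@gballM _ _ 1 1); [|apply: gballV]; apply: g1.
  - by apply: (@gballM _ _ 1 1); [|apply: gballV]; apply: g2.
  - by apply: (@sub_gball _ _ 1) => //; apply: g1.
  - by apply: (@sub_gball _ _ 1) => //; apply: g2.
have smV g : small g -> small g^-1 by case=> ? ?; split; exact: gballV.
have sm1 : small 1 by split; exact: gball1.
pose S := map sp D ++ map (fun d => (sp d)^-1) D.
have SP s : s \in S -> exists2 d, d \in D & s = sp d \/ s = (sp d)^-1.
  rewrite mem_cat => /orP[|] /mapP[d dD ->]; exists d => //; by [left|right].
have spI : {in D &, injective sp}.
  move=> [p q] [p' q'] /DP[/= pA qB] /DP[/= pA' qB'] h.
  have [|-> -> //] := K p q p' q' 1 1 pA pA' qB qB' sm1 sm1.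
  by rewrite gmul1 gmulr1.
have uD : uniq D.
  by rewrite allpairs_uniq ?allpairs_uniq//; move=> [? ?] [? ?] _ _ [-> ->].
exists S; split.
  split.
  - rewrite cat_uniq; apply/and3P; split.
    + by rewrite map_inj_in_uniq.
    + apply/hasPn => x /mapP[[p q] /DP[/= pA qB] ->].
      apply/negP => /mapP[[p' q'] /DP[/= pA' qB']] h.
      apply: (M p q p' q' 1 1) => //.
      by rewrite gmul1 gmulr1 -h gmulrV.
    + rewrite map_inj_in_uniq// => x y xD yD h.
      exact: spI (ginv_inj h).
  - rewrite -size_eq0 size_cat !size_map addn_eq0 andbb.
    by rewrite !size_allpairs !muln_eq0 !size_eq0 (negbTE A0) (negbTE B0).
  - move=> s /SP[d dD [->|->]]; rewrite mem_cat; apply/orP.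
      by right; apply/mapP; exists d.
    by left; apply/mapP; exists d; rewrite ?ginvK.
  - move=> u v u' v' s s' uF vF uF' vF' /SP[[p q] /DP[/= pA qB] hs].
    move=> /SP[[p' q'] /DP[/= pA' qB'] hs'] h.
    have [Hu _ _] := smF u' u uF' uF.
    have [_ Hv _] := smF v v' vF vF'.
    have [Hu' _ _] := smF u u' uF uF'.
    have [_ Hv' _] := smF v' v vF' vF.
    have h2 : u'^-1 * u * s * (v * v'^-1) = s'.
      apply: (@gmulI _ u'); apply: (@gmulIr _ v').
      by move: h; gsimp.
    case: hs hs' => hs [] hs'.
    + have [|_ _ /gmul_eq1] := K p q p' q' _ _ pA pA' qB qB' Hu Hv.
        by rewrite -hs -hs'.
      by move=> /ginv_inj ->.
    + exfalso; apply: (M p q p' q' (u'^-1 * u) (v * v'^-1)) => //.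
      by rewrite -hs h2 hs' gmulV.
    + exfalso; apply: (M p' q' p q (u^-1 * u') (v' * v^-1)) => //.
      have -> : u^-1 * u' * sp (p', q') * (v' * v^-1) = s.
        by rewrite -hs' -h2; gsimp.
      by rewrite hs gmulV.
    (* For two inverse letters left and right are exchanged: [K] yields the equality of the letters
       and of [v] and [v'], and [u = u'] follows by cancellation. *)
    + have h3 : v' * v^-1 * sp (p, q) * (u^-1 * u') = sp (p', q').
        apply: ginv_inj; by rewrite -hs' -h2 hs; gsimp.
      have [//|pp qq /gmul_eq1 vv] := K p q p' q' _ _ pA pA' qB qB' Hv' Hu'.
      move: vv; rewrite ginvK => vv.
      move: h; rewrite hs hs' pp qq vv => h.
      by apply: (@gmulIr _ ((sp (p', q'))^-1 * v)); rewrite !gmulA.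
  - move=> u v s uF vF /SP[[p q] /DP[/= pA qB] hs]; apply/negP => h.
    have [Huf _ su] := smF (u * s * v) u h uF.
    have [_ Hvf sv] := smF (u * s * v) v h vF.
    case: hs => hs.
      apply: (N p q ((u * s * v)^-1 * u) v) => //.
      by rewrite -hs; gsimp.
    apply: (N p q (u * s * v * v^-1) u^-1) => //; first exact: smV.
    by rewrite hs; gsimp.
have szD : size D = (size A * size A * (size B * size B))%N.
  by rewrite !size_allpairs.
move=> H Hc H01 g gF.
have -> : size S = (size D + size D)%N by rewrite size_cat !size_map.
rewrite /S !big_cat !big_map natrD !mulrDr.
have AFg : (n * count (fun a => (g.1 * a)%cg \notin A) A <= size A)%N.
  apply: ltnW; apply: leq_ltn_trans (AF g.1 _); last exact: map_f.
  by rewrite leq_mul2l leq_addr orbT.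
have BFg : (n * count (fun a => (g.2 * a)%cg \notin B) B <= size B)%N.
  apply: ltnW; apply: leq_ltn_trans (BF g.2 _); last exact: map_f.
  by rewrite leq_mul2l leq_addr orbT.
have le2 (a b c d k : R) : (n%:R * a <= n%:R * b + k -> n%:R * c <= n%:R * d + k ->
    n%:R * a + n%:R * c <= n%:R * b + n%:R * d + (k + k))%R.
  by move=> h1 h2; rewrite addrACA lerD.
have s1 (k : G -> G) : (\sum_(d <- D) H (k (sp d)) = \sum_(d <- D) H (1 * k (sp d))%cg)%R.
  by apply: eq_bigr => d _; rewrite gmul1.
rewrite (s1 id) (s1 ginv).
case: Hc => -[f Hf].
- have f01 x : (0 <= f x <= 1)%R by rewrite -(Hf (x, 1)).
  pose r := [seq (a, q) | a <- A, q <- BB].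
  have szr : (size r * size A = size D)%N.
    by rewrite szD !size_allpairs mulnAC.
  have e1 (h : G) : (\sum_(d <- D) H (h * sp d)%cg =
     \sum_(i <- r) \sum_(a <- A) f ((h.1 * a) * (psi i.2 * i.1^-1))%cg)%R.
    rewrite !big_allpairs exchange_big; apply: eq_bigr => a' _ /=.
    rewrite exchange_big; apply: eq_bigr => q _ /=; apply: eq_bigr => a _.
    by rewrite Hf /=; congr f; rewrite /= !gmulA.
  have e2 (h : G) : (\sum_(d <- D) H (h * (sp d)^-1)%cg =
     \sum_(i <- r) \sum_(a <- A) f ((h.1 * a) * ((psi i.2)^-1 * i.1^-1))%cg)%R.
    rewrite !big_allpairs; apply: eq_bigr => a' _ /=.
    rewrite exchange_big; apply: eq_bigr => q _ /=; apply: eq_bigr => a _.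
    rewrite Hf /=; congr f.
    by gsimp.
  rewrite !e1 !e2; apply: le2.
    have := Foelner_family r (f := fun i x => f (x * (psi i.2 * i.1^-1))) uA AFg.
    rewrite szr => /(_ _)h; under [X in (_ <= _ * X + _)%R]eq_bigr do
      under eq_bigr do rewrite gmul1.
    by apply: h => i x.
  have := Foelner_family r (f := fun i x => f (x * ((psi i.2)^-1 * i.1^-1))) uA AFg.
  rewrite szr => /(_ _)h; under [X in (_ <= _ * X + _)%R]eq_bigr do
      under eq_bigr do rewrite gmul1.
  by apply: h => i x.
- have f01 x : (0 <= f x <= 1)%R by rewrite -(Hf (1, x)).
  pose r := [seq (b, p) | b <- B, p <- AA].
  have szr : (size r * size B = size D)%N.
    by rewrite szD !size_allpairs mulnC [RHS]mulnC mulnA.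
  have e1 (h : G) : (\sum_(d <- D) H (h * sp d)%cg =
     \sum_(i <- r) \sum_(b <- B) f ((h.2 * b) * (phi i.2 * i.1^-1))%cg)%R.
    rewrite big_allpairs /r [RHS]big_allpairs [RHS]exchange_big; apply: eq_bigr => p _ /=.
    rewrite big_allpairs exchange_big; apply: eq_bigr => b' _ /=; apply: eq_bigr => b _.
    by rewrite Hf /=; congr f; rewrite /= !gmulA.
  have e2 (h : G) : (\sum_(d <- D) H (h * (sp d)^-1)%cg =
     \sum_(i <- r) \sum_(b <- B) f ((h.2 * b) * ((phi i.2)^-1 * i.1^-1))%cg)%R.
    rewrite big_allpairs /r [RHS]big_allpairs [RHS]exchange_big; apply: eq_bigr => p _ /=.
    rewrite big_allpairs; apply: eq_bigr => b' _ /=; apply: eq_bigr => b _.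
    rewrite Hf /=; congr f.
    by gsimp.
  rewrite !e1 !e2; apply: le2.
    have := Foelner_family r (f := fun i x => f (x * (phi i.2 * i.1^-1))) uB BFg.
    rewrite szr => /(_ _)h; under [X in (_ <= _ * X + _)%R]eq_bigr do
      under eq_bigr do rewrite gmul1.
    by apply: h => i x.
  have := Foelner_family r (f := fun i x => f (x * ((phi i.2)^-1 * i.1^-1))) uB BFg.
  rewrite szr => /(_ _)h; under [X in (_ <= _ * X + _)%R]eq_bigr do
      under eq_bigr do rewrite gmul1.
  by apply: h => i x.
Qed.
End Switching.

(** * The sequence of letter sets and unique decoding *)

Section Letters.
Local Open Scope cgroup_scope.
Variables (R : realType) (G : cgroup) (C : (G -> R) -> Prop).

(** The two index conditions take care of the elements that are no letters; inversion exchanges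
    them. *)
Definition low (S : nat -> seq G) (t : nat) (x : G) :=
  (exists2 j, (j < t)%N & x \in S j) \/ (pickle x < t)%N \/ (pickle x^-1 < t)%N.

(** In the last clause a product of at most [L t] low elements is written as the displacement along
    a path [z], the form in which a random walk supplies it. *)
Definition switching_sequence (L N : nat -> nat) (S F : nat -> seq G) :=
  [/\ forall t, switching (F t) (S t),
   forall t H, C H -> (forall x, 0 <= H x <= 1)%R ->
     almost_invariant (N t) (F t) (S t) H,
   forall t, {subset F t <= F t.+1},
   forall t u v s, u \in F t -> v \in F t -> s \in S t -> u * s * v \in F t.+1 &
   (forall t g, g \in F t -> g^-1 \in F t) /\
   forall t k (z : nat -> G), (k <= L t)%N ->
     (forall i, (i < k)%N -> low S t ((z i)^-1 * z i.+1)) ->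
     (z 0)^-1 * z k \in F t].

(** [S t] has to be chosen after [F t], which must already absorb all earlier letters. The list
    [base] keeps the history of this recursion together with the elements of index below [t], so
    that every low element is a generator or the inverse of one. *)
Lemma switching_sequence_exists (L N : nat -> nat) :
  (forall t, 0 < N t)%N ->
  (forall F n, (0 < n)%N -> exists S, switching F S /\
     forall H, C H -> (forall x, 0 <= H x <= 1)%R -> almost_invariant n F S H) ->
  exists S F, switching_sequence L N S F.
Proof.
move=> N0 sw.
have /choice[sel selP] : forall Fn : seq G * nat, exists S, (0 < Fn.2)%N ->
    switching Fn.1 S /\ forall H, C H -> (forall x, 0 <= H x <= 1)%R ->
      almost_invariant Fn.2 Fn.1 S H.
  move=> [F [|n]]; first by exists [::].
  by have [S SP] := sw F n.+1 isT; exists S.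
(* Radius at least 3 puts the products [u * s * v] into the next set. *)
pose l t := maxn 3 (L t).
pose fix base t := if t is t'.+1 then
    let F := gball (base t') (l t') in
    F ++ sel (F, N t') ++ pmap unpickle (iota 0 t'.+1)
  else [::].
pose F t := gball (base t) (l t); pose S t := sel (F t, N t).
have l0 t : (0 < l t)%N by rewrite /l; lia.
have baseS t : base t.+1 = F t ++ S t ++ pmap unpickle (iota 0 t.+1) by [].
have baseF t : {subset base t <= F t} by move=> x xb; apply: gball_mem.
have FS t : {subset F t <= base t.+1} by move=> x xF; rewrite baseS mem_cat xF.
have SS t : {subset S t <= base t.+1}.
  by move=> x xF; rewrite baseS !mem_cat xF orbT.
have base_mono t u : (t <= u)%N -> {subset base t <= base u}.
  move=> /subnK <-; elim: (u - t)%N => // k IH x xb.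
  by rewrite addSn; apply/FS/baseF/IH.
have low_base t x : low S t x -> x \in base t ++ map ginv (base t).
  have pick y : (pickle y < t)%N -> y \in base t.
    case: t => // t yt; rewrite baseS !mem_cat mem_pmap; apply/orP; right.
    apply/orP; right; apply/mapP; exists (pickle y); last by rewrite pickleK.
    by rewrite mem_iota add0n.
  rewrite mem_cat => -[[j jt xS]|[/pick ->//|/pick xb]].
    by rewrite (base_mono _ _ jt)// SS.
  by apply/orP; right; apply/mapP; exists x^-1; rewrite ?ginvK.
exists S, F; split.
- by move=> t; have [] := selP (F t, N t) (N0 t).
- by move=> t; have [] := selP (F t, N t) (N0 t).
- by move=> t x xF; apply/baseF/FS.
- move=> t u v s uF vF sS; apply: (@sub_gball _ _ 3); first by rewrite /l; lia.
  apply: (@gballM _ _ 2 1); last by apply: gball_mem => //; exact: FS.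
  by apply: (@gballM _ _ 1 1); apply: gball_mem => //; [exact: FS|exact: SS].
- split=> [t g gF|t k z kL zP]; first exact: gballV.
  suff : (z 0)^-1 * z k \in gball (base t) k by apply: sub_gball; rewrite /l; lia.
  elim: k {kL} zP => [|k IH] zP; first by rewrite gmulV gball1.
  have -> : (z 0)^-1 * z k.+1 = (z 0)^-1 * z k * ((z k)^-1 * z k.+1) by gsimp.
  apply: gballS; last by apply/low_base/zP.
  by apply: IH => i ik; apply: zP; lia.
Qed.

Section Tree.
Variables (L N : nat -> nat) (S F : nat -> seq G).
Hypothesis ss : switching_sequence L N S F.

Lemma F_mono t u : (t <= u)%N -> {subset F t <= F u}.
Proof.
case: ss => _ _ FS _ _ /subnK <-; elim: (u - t)%N => // k IH x xF.
by rewrite addSn; apply/FS/IH.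
Qed.

Lemma F1 t : 1 \in F t.
Proof.
case: ss => _ _ _ _ [_ /(_ t 0%N (fun=> 1))]; rewrite gmulV.
by apply.
Qed.

Lemma low_F t x : (0 < L t)%N -> low S t x -> x \in F t.
Proof.
case: ss => _ _ _ _ [_ h] Lt xl.
have := h t 1%N (fun i => if i is 0 then 1 else x) Lt.
rewrite ginv1 gmul1; apply=> -[|//] _.
by rewrite ginv1 gmul1.
Qed.

Lemma letter_notin_F t s : s \in S t -> s \notin F t.
Proof.
case: ss => sw _ _ _ _ sS; have [_ _ _ _ h] := sw t.
by have := h 1 1 s (F1 t) (F1 t) sS; rewrite gmul1 gmulr1.
Qed.

Lemma letters_disjoint t u s : s \in S t -> s \in S u -> t = u.
Proof.
suff lt t' u' : s \in S t' -> s \in S u' -> ~ (t' < u')%N.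
  by move=> sT sU; have := lt _ _ sT sU; have := lt _ _ sU sT; lia.
move=> sT sU tu; have /negP := letter_notin_F sU; apply.
apply: (F_mono tu); case: ss => _ _ _ h _.
by have := h t' 1 1 s (F1 _) (F1 _) sT; rewrite gmul1 gmulr1.
Qed.

(* Positions that can be reached from [y] when every new maximal letter is read
   while both factors around it are still short. *)
Inductive tree (K : nat) (y : G) : G -> Prop :=
| tree_root : tree K y y
| tree_step t z s v : tree K y z -> (K <= t)%N -> z \in F t -> s \in S t ->
    v \in F t -> tree K y (z * s * v).

(** The last step leading to [x] is determined. If two types competed, the product with the smaller
    type would lie in [F] of the larger one, which a product with a letter of the larger type
    avoids. For equal types the decoding clause gives the same predecessor, and the induction goes
    down to the roots. *)
Lemma tree_disjoint K y y' x : y \in F K -> y' \in F K -> y <> y' ->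
  tree K y x -> tree K y' x -> False.
Proof.
case: (ss) => sw _ _ FSF _.
move=> yF yF' yy' T; elim: T => {x}.
  move=> T; case E : _ / T yy' yF => [//|t z s v _ Kt zF sS vF] _ yF.
  have [_ _ _ _ /(_ _ _ _ zF vF sS)/negP] := sw t.
  by apply; apply: (F_mono Kt).
move=> t z s v Tz IH Kt zF sS vF T.
move E : (z * s * v) T => x T.
case: T E => [|t' z' s' v' Tz' Kt' zF' sS' vF'] E.
  have [_ _ _ _ /(_ _ _ _ zF vF sS)/negP] := sw t.
  by apply; apply: (F_mono Kt); rewrite E.
have [tt'|t't|ett'] := ltngtP t t'.
- have [_ _ _ _ /(_ _ _ _ zF' vF' sS')/negP] := sw t'.
  by apply; apply: (F_mono tt'); rewrite -E; apply: FSF.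
- have [_ _ _ _ /(_ _ _ _ zF vF sS)/negP] := sw t.
  by apply; apply: (F_mono t't); rewrite E; apply: FSF.
- subst t'; have [_ _ _ dec _] := sw t.
  by apply: IH; rewrite (dec _ _ _ _ _ _ zF vF zF' vF' sS sS' E).
Qed.

End Tree.
End Letters.

(** * Random walks *)

Section Esum.
Local Open Scope classical_set_scope.
Local Open Scope ring_scope.
Local Open Scope ereal_scope.

Lemma esumZl (R : realType) (T : choiceType) (I : set T) (a : T -> \bar R) (c : R) :
  (0 <= c)%R -> (forall i, 0 <= a i) ->
  \esum_(i in I) (c%:E * a i) = c%:E * \esum_(i in I) a i.
Proof.
have le (d : R) (b : T -> \bar R) : (0 <= d)%R -> (forall i, 0 <= b i) ->
    \esum_(i in I) (d%:E * b i) <= d%:E * \esum_(i in I) b i.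
  move=> d0 b0; apply: ge_ereal_sup => _ [X [finX XI]] <-.
  rewrite -ge0_mule_fsumr//.
  by apply: lee_wpmul2l; rewrite ?lee_fin// esum_ge//; exists X.
move=> c0 a0; apply/eqP; rewrite eq_le le//=.
have [->|cn0] := eqVneq c 0%R.
  by rewrite mul0e; apply: esum_ge0 => i Ii; rewrite mul0e.
have {}c0 : (0 < c)%R by rewrite lt_def cn0.
rewrite -lee_pdivlMl//.
have ca0 i : 0 <= c%:E * a i by rewrite mule_ge0 ?a0// lee_fin ltW.
have ci0 : (0 <= c^-1)%R by rewrite invr_ge0 ltW.
apply: le_trans (le _ _ ci0 ca0); apply: le_esum => i Ii.
by rewrite muleA -EFinM mulVf ?mul1e.
Qed.

Lemma measure_esum d (T : measurableType d) (R : realType)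
    (mu : {measure set T -> \bar R}) (U : countType) (F : U -> set T) :
  (forall x, measurable (F x)) -> trivIset setT F ->
  mu (\bigcup_x F x) = \esum_(x in [set: U]) mu (F x).
Proof.
move=> mF tF.
pose H n := if pickle_inv n is Some x then F x else set0 : set T.
have mH n : measurable (H n) by rewrite /H; case: pickle_inv.
have HP x : H (pickle x) = F x by rewrite /H pickleK_inv.
have HN n : ~ range (@pickle U) n -> H n = set0.
  rewrite /H => nr; case E : (@pickle_inv U n) => [x|//]; case: nr.
  by exists x => //; have := @pickle_invK U n; rewrite E.
have -> : \bigcup_x F x = \bigcup_n H n.
  apply/seteqP; split=> w [i _ Fi]; first by exists (pickle i); rewrite ?HP.
  move: Fi; rewrite /H; case: pickle_inv => [x Fx|//]; by exists x.
rewrite measure_semi_bigcup//; first last.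
- exact: bigcupT_measurable.
- move=> i j _ _ [w []]; rewrite /H.
  case Ei : (@pickle_inv U i) => [x|//]; case Ej : (@pickle_inv U j) => [y|//] Fx Fy.
  have xy : x = y by apply: tF => //; exists w.
  have := @pickle_invK U i; rewrite Ei /= => <-; rewrite xy.
  by have := @pickle_invK U j; rewrite Ej.
rewrite nneseries_esumT// (esumID (range (@pickle U)))// [X in _ + X]esum1 ?adde0.
  rewrite setTI esum_image; last by move=> x y _ _; exact: (pcan_inj pickleK).
  by apply: eq_esum => x _; rewrite HP.
by move=> n [_ /HN ->]; rewrite measure0.
Qed.
End Esum.

Section Walk.
Local Open Scope classical_set_scope.
Variables (R : realType) (G : cgroup).

Lemma measurable_coord (n : nat) (C : set G) :
  measurable [set w : Paths G | C (w n)].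
Proof.
have -> : [set w : Paths G | C (w n)] =
    \bigcup_(x : G) ([set w : Paths G | w n = x] `&` [set w | C x]).
  by apply/seteqP; split=> [w Cw|w [x _ [/= -> //]]]; exists (w n).
apply: countable_bigcupT_measurable; first exact: countableP.
move=> x; have [Cx|Cx] := pselect (C x).
  have -> : [set w : Paths G | C x] = setT by apply/seteqP; split.
  rewrite setIT; apply: sub_sigma_algebra; by exists n, x.
have -> : [set w : Paths G | C x] = set0 by apply/seteqP; split.
by rewrite setI0.
Qed.

Lemma measurable_prefix (n : nat) (Q : set (seq G)) :
  measurable [set w : Paths G | Q (mkseq w n)].
Proof.
have -> : [set w : Paths G | Q (mkseq w n)] =
    \bigcup_(l : seq G) ([set w : Paths G | mkseq w n = l /\ Q l]).
  by apply/seteqP; split=> [w Cw|w [x _ [/= -> //]]]; exists (mkseq w n).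
apply: countable_bigcupT_measurable; first exact: countableP.
move=> l.
have [[Ql sl]|h] := pselect (Q l /\ size l = n); last first.
  have -> : [set w : Paths G | mkseq w n = l /\ Q l] = set0 => //.
  by apply/seteqP; split=> // w [/= lE Ql]; apply: h; rewrite -{2}lE size_mkseq.
have -> : [set w : Paths G | mkseq w n = l /\ Q l] =
   \bigcap_(i in [set k | (k < n)%N]) [set w : Paths G | w i = nth gone l i].
  apply/seteqP; split=> w /=.
    by move=> [<- _] i /= ik; rewrite nth_mkseq.
  move=> h; split=> //; apply: (@eq_from_nth _ gone); rewrite size_mkseq// => i ik.
  by rewrite nth_mkseq// h.
apply: bigcap_measurableType => i _.
exact: (measurable_coord i [set x | x = nth gone l i]).
Qed.

Lemma measurable_determined (n : nat) (A : set (Paths G)) :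
  (forall w w' : Paths G, (forall i, (i < n)%N -> w i = w' i) -> A w -> A w') ->
  measurable A.
Proof.
move=> hA.
suff -> : A = [set w : Paths G | [set l : seq G | A (nth gone l)] (mkseq w n)].
  exact: measurable_prefix.
by apply/seteqP; split=> w /= ; apply: hA => i ik; rewrite nth_mkseq.
Qed.

Definition cyl (n : nat) (s : nat -> G) : set (Paths G) :=
  [set w : Paths G | forall i, (i <= n)%N -> w i = s i].

Lemma measurable_cyl n s : measurable (cyl n s).
Proof.
have -> : cyl n s = \bigcap_(i in [set k | (k <= n)%N]) [set w : Paths G | w i = s i].
  by apply/seteqP; split=> w h i; exact: h.
apply: bigcap_measurableType => i _.
exact: (measurable_coord i [set x | x = s i]).
Qed.

(** A cylinder fixes at least one coordinate, and two of them may be disjoint; [setT] and [set0] are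
    added to obtain a pi-system that covers the space, as [measure_unique] requires. *)
Definition cyls : set (set (Paths G)) :=
  [set A | A = set0 \/ A = setT \/ exists n s, A = cyl n s].

Lemma setI_closed_cyls : setI_closed cyls.
Proof.
move=> A B [->|[->|[n [s ->]]]]; rewrite ?set0I ?setTI//; first by left.
move=> [->|[->|[m [t ->]]]]; rewrite ?setI0 ?setIT//; first by left.
  by right; right; exists n, s.
wlog nm : n m s t / (n <= m)%N.
  move=> h; have [|/ltnW] := leqP n m; first exact: h.
  by rewrite setIC; exact: h.
have [st|st] := pselect (forall i, (i <= n)%N -> s i = t i); last first.
  left; apply/seteqP; split=> // w [/= ws wt]; apply: st => i ik.
  by rewrite -ws// wt// (leq_trans ik).
right; right; exists m, t; apply/seteqP; split=> w; first by case.
by move=> wt; split=> // i ik; rewrite wt ?st// (leq_trans ik).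
Qed.

Lemma measurable_cyls : @measurable _ (Paths G) = <<s cyls >>.
Proof.
apply/seteqP; split.
  apply: smallest_sub; first exact: smallest_sigma_algebra.
  move=> A [n [g ->]].
  have -> : [set w : paths G | w n = g] =
      \bigcup_(l : seq G) (if nth gone l n == g then cyl n (nth gone l) else set0).
    apply/seteqP; split=> w /=.
      move=> wn; exists (mkseq w n.+1) => //.
      rewrite nth_mkseq// wn eqxx => i ik.
      by rewrite nth_mkseq.
    by move=> [l _]; case: eqP => // <- /(_ n); apply.
  pose T := g_sigma_algebraType cyls.
  apply: (@countable_bigcupT_measurable _ T); first exact: countableP.
  move=> l; case: eqP => _; apply: sub_sigma_algebra; last by left.
  by right; right; exists n, (nth gone l).
apply: smallest_sub; first exact: sigma_algebra_measurable.
move=> A [->|[->|[n [s ->]]]]; [exact: measurable0|exact: measurableT|].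
exact: measurable_cyl.
Qed.

Lemma eq_measure_cyl (m1 m2 : ({measure set (Paths G) -> \bar R})%R) :
  m1 setT = m2 setT -> (m1 setT < +oo)%E ->
  (forall n s, m1 (cyl n s) = m2 (cyl n s)) ->
  forall A, measurable A -> m1 A = m2 A.
Proof.
move=> hT hoo hc A mA.
apply: (@measure_unique _ _ _ cyls (fun=> setT)) => //.
- exact: measurable_cyls.
- exact: setI_closed_cyls.
- by move=> _; right; left.
- by rewrite bigcup_const//; exists 0%N.
- by move=> B [->|[->//|[n [s ->]]]]; rewrite ?measure0.
Qed.

Definition shiftn (n : nat) (w : Paths G) : Paths G := fun i => w (n + i)%N.

Lemma measurable_shiftn n : measurable_fun setT (shiftn n).
Proof.
apply: (@measurability _ _ _ _ _ (shiftn n) (@cylinders G)) => //.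
move=> _ [_ [k [g ->]] <-]; rewrite setTI.
exact: (measurable_coord (n + k) [set x | x = g]).
Qed.

Lemma measurable_gact g : measurable_fun setT (gact (G := G) g).
Proof.
apply: (@measurability _ _ _ _ _ (@gact G g) (@cylinders G)) => //.
move=> _ [_ [k [h ->]] <-]; rewrite setTI.
exact: (measurable_coord k [set x | gmul g x = h]).
Qed.

Lemma gact_preM x z (A : set (Paths G)) :
  gact x @^-1` (gact z @^-1` A) = gact (gmul z x) @^-1` A.
Proof.
have E (w : Paths G) : gact z (gact x w) = gact (gmul z x) w.
  by apply: funext => i; rewrite /gact gmulA.
by apply/seteqP; split=> w; rewrite /preimage /= E.
Qed.

Lemma gact_pre1 (A : set (Paths G)) : gact gone @^-1` A = A.
Proof.
have E (w : Paths G) : gact gone w = w by apply: funext => i; rewrite /gact gmul1.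
by apply/seteqP; split=> w; rewrite /preimage /= E.
Qed.

(** * Markov property, harmonic functions and independence of increments *)

Section Law.
Local Open Scope ring_scope.
Variables (nu : G -> R) (P : probability (Paths G) R).
Hypothesis Plaw : rw_law nu P.

Lemma rw_law_ge0 g : 0 <= nu g.
Proof.
have := Plaw 0 (fun=> g); rewrite big_ord1 /= => h.
by rewrite -lee_fin -h.
Qed.

Lemma measurable_gact_pre g A : measurable A ->
  measurable (gact (G := G) g @^-1` A).
Proof.
by move=> mA; rewrite -[X in measurable X]setTI; exact: measurable_gact.
Qed.

(** Given its first [n.+1] positions, the walk continues as a fresh walk multiplied by [s n]. Both
    sides are finite measures in [A], so it suffices to compare them on cylinders, where the product
    formula of [rw_law] splits. *)
Lemma markov n s A : measurable A ->
  (P (cyl n s `&` shiftn n.+1 @^-1` A) =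
   (\prod_(i < n.+1) nu (increment s i))%:E * P (gact (s n) @^-1` A))%E.
Proof.
move=> mA.
set c := \prod_(i < n.+1) _.
have c0 : 0 <= c by apply: prodr_ge0 => i _; exact: rw_law_ge0.
pose m1 := measure_function_pushforward__canonical__measure_function_Measure
  (mrestr P (measurable_cyl n s)) (measurable_shiftn n.+1).
pose m2 := mscale (NngNum c0)
  (measure_function_pushforward__canonical__measure_function_Measure P
     (measurable_gact (s n))).
suff h : m1 A = m2 A.
  move: h; rewrite /m1 /m2 /mscale /= /pushforward /mrestr /= => <-.
  by rewrite setIC.
apply: eq_measure_cyl mA.
- transitivity c%:E; last first.
    by rewrite -[LHS]mule1; congr (_ * _)%E; exact/esym/probability_setT.
  by rewrite /m1 /= /pushforward /mrestr preimage_setT setTI /cyl Plaw.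
- rewrite /m1 /= /pushforward /mrestr /= preimage_setT setTI.
  by rewrite /cyl Plaw ltry.
move=> m r; rewrite /m1 /m2 /mscale /= /pushforward /mrestr /=.
(* [t] is [s] continued by [r]. At the junction the increment runs from [s n] to [r 0], which is the
   first increment of [r] translated by the inverse of [s n]. *)
pose t i := if (i <= n)%N then s i else r (i - n.+1)%N.
transitivity (P (cyl (n.+1 + m) t)).
  congr (P _).
  apply/seteqP; split=> w /=.
    move=> [wr ws] i im; rewrite /t; case: leqP => [|ni]; first exact: ws.
    by rewrite -wr /shiftn ?subnKC//; lia.
  move=> wt; split=> i ik.
    rewrite /shiftn wt; last by lia.
    by rewrite /t ifF ?addKn//; lia.
  by rewrite wt /t ?ik//; lia.
transitivity (c%:E * P (cyl m (fun i => gmul (ginv (s n)) (r i))))%E; last first.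
  congr (_ * P _)%E; symmetry.
  apply/seteqP; split=> w wr i ik.
    by rewrite -wr// /gact gVK.
  by rewrite /gact wr// gKV.
rewrite /cyl !Plaw -EFinM; congr (_%:E); rewrite /c.
rewrite -addnS big_split_ord /=; congr (_ * _).
  apply: eq_bigr => i _; congr nu; rewrite /increment /t.
  case: i => -[|i] //= ik.
  have -> : (i < n)%N = true by lia.
  by have -> : (i <= n)%N = true by lia.
apply: eq_bigr => -[[|i] ik] _ /=; rewrite /t; congr nu.
  by rewrite !addn0 leqnn ltnn subnn.
have -> : (n + i.+1 <= n)%N = false by lia.
have -> : (n.+1 + i.+1 <= n)%N = false by lia.
have -> : (n + i.+1 - n.+1)%N = i by lia.
have -> : (n.+1 + i.+1 - n.+1)%N = i.+1 by lia.
by gsimp.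
Qed.

Lemma prob_first_step A : measurable A ->
  P A = (\esum_(x in [set: G]) P (cyl 0 (fun=> x) `&` A))%E.
Proof.
move=> mA; rewrite -measure_esum; last first.
- move=> x y _ _ [w [[/(_ _ (leqnn 0)) <- _] [/(_ _ (leqnn 0)) <- _]]] //.
- by move=> x; apply: measurableI => //; exact: measurable_cyl.
congr (P _); apply/seteqP; split=> [w Aw|w [x _ []//]].
by exists (w 0%N) => //; split=> // i; rewrite leqn0 => /eqP ->.
Qed.

Lemma invariant_gact z A : invariant_event A ->
  invariant_event (gact (G := G) z @^-1` A).
Proof.
move=> [mA iA]; split; first exact: measurable_gact_pre.
by rewrite -[in RHS]iA.
Qed.

Lemma invariant_shiftn n A : invariant_event A -> shiftn n @^-1` A = A.
Proof.
move=> [_ iA]; elim: n => [|n IH] //.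
by rewrite -[in RHS]iA -[in RHS]IH.
Qed.

(** The Poisson transform of the indicator of [A] is harmonic: condition on the first step and use
    that [A] does not change under the shift. *)
Lemma harmonic_invariant z A : invariant_event A ->
  P (gact z @^-1` A) =
  (\esum_(x in [set: G]) ((nu x)%:E * P (gact (gmul z x) @^-1` A)))%E.
Proof.
move=> iA; have iB := invariant_gact z iA.
rewrite prob_first_step; last exact: (iB.1).
apply: eq_esum => x _.
rewrite -{1}(invariant_shiftn 1 iB) markov; last exact: (iB.1).
by rewrite big_ord1 /= gact_preM.
Qed.

(* By [markov], [A] is independent of every cylinder, hence of itself. *)
Lemma constant_harmonic_trivial :
  (forall A, invariant_event A ->
     forall z, P (gact z @^-1` A) = P (gact gone @^-1` A)) -> tail_trivial P.
Proof.
move=> hconst A iA.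
have [mA _] := iA.
pose p := fine (P A).
have PA : P A = p%:E by rewrite /p fineK// fin_num_measure.
have p0 : 0 <= p by rewrite -lee_fin -PA.
have key : P A = (p%:E * P A)%E.
  have : forall B, measurable B ->
      (mrestr P mA : {measure set (Paths G) -> \bar R}) B =
      (mscale (NngNum p0) P : {measure set (Paths G) -> \bar R}) B.
    apply: eq_measure_cyl.
    - rewrite /= /mrestr /mscale /= setTI PA -[LHS]mule1.
      by congr (_ * _)%E; exact/esym/probability_setT.
    - by rewrite /= /mrestr setTI PA ltry.
    move=> n s; rewrite /= /mrestr /mscale /= -{1}(invariant_shiftn n.+1 iA).
    by rewrite markov// hconst// gact_pre1 PA muleC /cyl Plaw.
  by move=> /(_ A mA); rewrite /= /mrestr /mscale /= setIid.
have : p = p * p by move: key; rewrite PA -EFinM => -[].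
move=> /eqP; rewrite -subr_eq0 -{1}[p]mulr1 -mulrBr mulf_eq0 subr_eq0.
by rewrite PA => /orP[/eqP ->|/eqP <-]; [left|right].
Qed.

Definition increments_in (n : nat) (C : nat -> set G) : set (Paths G) :=
  [set w | forall i, (i < n)%N -> C i (increment w i)].

Lemma measurable_increments_in n C : measurable (increments_in n C).
Proof.
apply: (@measurable_determined n) => w w' ww' h i ik.
have := h i ik; rewrite /increment; case: i ik => [|i] ik; rewrite !ww'//.
exact: ltnW.
Qed.

(** Independence of the increments, in the form of an upper bound. The first increment is split off
    with [markov], and translating by its inverse turns the rest into the same event for a fresh
    walk. *)
Lemma increments_in_le n (C : nat -> set G) (c : nat -> R) :
  (forall i, (i < n)%N -> 0 <= c i) ->
  (forall i, (i < n)%N -> (\esum_(x in C i) (nu x)%:E <= (c i)%:E)%E) ->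
  (P (increments_in n C) <= (\prod_(i < n) c i)%:E)%E.
Proof.
elim: n C c => [|n IH] C c c0 Cc.
  by rewrite big_ord0; exact: probability_le1 (measurable_increments_in _ _).
pose C' i := C i.+1.
rewrite prob_first_step; last exact: measurable_increments_in.
have E x : P (cyl 0 (fun=> x) `&` increments_in n.+1 C) =
   (if x \in C 0%N then (nu x)%:E * P (increments_in n C') else 0)%E.
  case: ifPn => xC; last first.
    rewrite (_ : _ `&` _ = set0) ?measure0//; apply/seteqP; split=> // w.
    move=> [/(_ _ (leqnn 0)) wx /(_ 0%N isT) /=].
    by rewrite wx; move: xC; rewrite notin_setE.
  have -> : cyl 0 (fun=> x) `&` increments_in n.+1 C =
     cyl 0 (fun=> x) `&` shiftn 1 @^-1` (gact (ginv x) @^-1` increments_in n C').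
    apply/seteqP; split=> w [wx wC]; split=> //.
      have w0 : w 0%N = x by exact: wx.
      move=> i ik; have := wC i.+1 ik; rewrite /C' /= /gact /shiftn.
      case: i ik => [|i] ik /=; first by rewrite w0.
      by rewrite ginvM ginvK -gmulA gKV.
    have w0 : w 0%N = x by exact: wx.
    case=> [_|i ik] /=; first by rewrite w0; move: xC; rewrite inE.
    have := wC i ik; rewrite /C' /= /gact /shiftn.
    case: i ik => [|i] ik /=; first by rewrite w0.
    by rewrite ginvM ginvK -gmulA gKV.
  rewrite markov; last by apply: measurable_gact_pre; exact: measurable_increments_in.
  by rewrite big_ord1 /= gact_preM gmulV gact_pre1.
rewrite (eq_esum (fun x _ => E x)) -esum_mkcond big_ord_recl EFinM.
have [q Pq] : exists q, P (increments_in n C') = q%:E.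
  exists (fine (P (increments_in n C'))); rewrite fineK// fin_num_measure//.
  exact: measurable_increments_in.
have q0 : 0 <= q by rewrite -lee_fin -Pq.
have IHq : (q%:E <= (\prod_(i < n) c (lift ord0 i))%:E)%E.
  by rewrite -Pq; apply: (IH C' (fun i => c i.+1)) => i ik; [exact: c0|exact: Cc].
under eq_esum do rewrite Pq muleC.
rewrite esumZl//; last by move=> x; rewrite lee_fin rw_law_ge0.
rewrite muleC lee_pmul//; last exact: Cc.
by apply: esum_ge0 => x _; rewrite lee_fin rw_law_ge0.
Qed.
End Law.
End Walk.

(** * The step distribution *)

Section EsumMore.
Local Open Scope classical_set_scope.
Local Open Scope ring_scope.
Variable R : realType.

Lemma sub_esum (T : choiceType) (A B : set T) (f : T -> \bar R) :
  A `<=` B -> (\esum_(x in A) f x <= \esum_(x in B) f x)%E.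
Proof.
move=> AB; apply: ge_ereal_sup => _ [X [finX XA] <-].
by apply: esum_ge; exists X => //; split=> // x /XA /AB.
Qed.

Lemma esum_fibers (T U : choiceType) (pi : T -> U) (f : T -> \bar R) :
  (forall x, 0%R <= f x)%E ->
  (\esum_(x in [set: T]) f x =
   \esum_(u in [set: U]) \esum_(x in pi @^-1` [set u]) f x)%E.
Proof.
move=> f0; rewrite (@esum_esum _ _ _ _ _ (fun _ x => f x))//.
rewrite (@reindex_esum _ _ _ [set: T] _ (fun x => (pi x, x)))//.
split=> [x _|x y _ _ [] //|[u x] [_ /= <-]]; first by split.
by exists x.
Qed.

Lemma esum_seq (T : choiceType) (s : seq T) (f : T -> R) : uniq s ->
  (forall x, 0 <= f x) ->
  (\esum_(x in [set` s]) (f x)%:E = (\sum_(x <- s) f x)%:E)%E.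
Proof.
move=> us f0; rewrite esum_fset//; last by move=> x _; rewrite lee_fin.
  by rewrite -fsbig_seq// sumEFin.
Qed.

Lemma esum_nat_le (f : nat -> R) (c : R) : (forall n, 0 <= f n) ->
  (forall n, \sum_(0 <= k < n) f k <= c) ->
  (\esum_(n in [set: nat]) (f n)%:E <= c%:E)%E.
Proof.
move=> f0 fc; rewrite -nneseries_esumT; last by move=> n; rewrite lee_fin.
apply: lime_le; first by apply: is_cvg_nneseries => n _ _; rewrite lee_fin.
by apply: nearW => n; rewrite sumEFin lee_fin.
Qed.

Lemma esum_telescope (e : nat -> R) (t : nat) :
  (forall n, 0 <= e n) -> (forall n, e n.+1 <= e n) ->
  (\esum_(n in [set n | (t <= n)%N]) (e n - e n.+1)%:E <= (e t)%:E)%E.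
Proof.
move=> e0 eS; rewrite esum_mkcond.
pose f n := if (t <= n)%N then e n - e n.+1 else 0.
rewrite (eq_esum (b := fun n => (f n)%:E)); last first.
  move=> n _; rewrite /f; case: ifPn; rewrite ?inE /=; first by move=> ->.
  by rewrite notin_setE /= => /negP/negbTE ->.
apply: esum_nat_le => [n|n]; first by rewrite /f; case: ifP => // _; rewrite subr_ge0.
suff : \sum_(0 <= k < n) f k <= if (n <= t)%N then 0 else e t - e n.
  by move=> /le_trans; apply; case: ifP => // _; rewrite lerBlDr lerDl.
elim: n => [|n IH]; first by rewrite big_nil.
rewrite big_nat_recr//= {2}/f; move: IH; have [nt|tn|<-] := ltngtP n t.
- by move=> h; rewrite addr0.
- by move=> h; apply: le_trans (lerD h (lexx _)) _; rewrite addrA subrK.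
- by move=> h; rewrite gerDr.
Qed.
End EsumMore.

Section StepMeasure.
Local Open Scope classical_set_scope.
Local Open Scope ring_scope.
Variables (R : realType) (G : cgroup) (S : nat -> seq G).
Hypotheses (uS : forall t, uniq (S t)) (S0 : forall t, S t != [::])
  (SV : forall t s, s \in S t -> ginv s \in S t)
  (Sdisj : forall t u s, s \in S t -> s \in S u -> t = u).

(* [S t] gets weight [harm t - harm t.+1], about [t^-2]: the largest type read
   grows, but type [t] is tied for the maximum with probability [O(t^-2)] only.
   The remaining elements get weights decaying fast enough that the ones of
   index at least [t] are unlikely to occur within [len t] steps. *)
Definition harm (n : nat) : R := n.+1%:R^-1.
Definition tiny (n : nat) : R := (n.+2%:R ^+ 5)^-1.

Definition letter : set G := [set x | exists t, x \in S t].

(** Telescoping differences make the tails explicit. An element that is no letter gets the share of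
    its own index and that of its inverse, for symmetry. *)
Definition weight (x : G) : R :=
  if pselect (letter x) is left h then
    let t := projT1 (cid h) in (harm t - harm t.+1) / (size (S t))%:R
  else (tiny (pickle x) - tiny (pickle x).+1) +
       (tiny (pickle (ginv x)) - tiny (pickle (ginv x)).+1).

Lemma weight_letter t x : x \in S t ->
  weight x = (harm t - harm t.+1) / (size (S t))%:R.
Proof.
move=> xS; rewrite /weight; case: pselect => [h|]; last by case; exists t.
by case: cid => u uS' /=; rewrite (Sdisj uS' xS).
Qed.

Lemma harm_gt n : harm n.+1 < harm n.
Proof. by rewrite /harm ltf_pV2 ?posrE ?ltr0n// ltr_nat. Qed.

Lemma harm_ge0 n : 0 <= harm n. Proof. by rewrite invr_ge0. Qed.

Lemma tiny_gt n : tiny n.+1 < tiny n.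
Proof.
rewrite /tiny ltf_pV2 ?posrE ?exprn_gt0 ?ltr0n//.
by rewrite ltr_pXn2r ?nnegrE ?ler0n// ltr_nat.
Qed.

Lemma tiny_ge0 n : 0 <= tiny n.
Proof. by rewrite invr_ge0 exprn_ge0. Qed.

Lemma weight_gt0 x : 0 < weight x.
Proof.
rewrite /weight; case: pselect => [h|_].
  case: cid => t xS /=; rewrite divr_gt0 ?subr_gt0 ?harm_gt// ltr0n lt0n size_eq0.
  exact: S0.
by rewrite addr_gt0 ?subr_gt0 ?tiny_gt.
Qed.

Lemma weightV x : weight (ginv x) = weight x.
Proof.
have [[t xS]|nx] := pselect (letter x).
  by rewrite (weight_letter xS) (weight_letter (SV xS)).
have nxV : ~ letter (ginv x) by move=> [t /SV]; rewrite ginvK => xS; apply: nx; exists t.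
rewrite /weight; case: pselect => // _; case: pselect => // _.
by rewrite ginvK addrC.
Qed.

Lemma esum_weight_letter t :
  (\esum_(x in [set` S t]) (weight x)%:E = (harm t - harm t.+1)%:E)%E.
Proof.
rewrite esum_seq//; last by move=> x; rewrite ltW// weight_gt0.
congr (_%:E); rewrite big_seq (eq_bigr (fun=> (harm t - harm t.+1) / (size (S t))%:R));
  last by move=> x; exact: weight_letter.
rewrite -big_seq big_const_seq count_predT iter_addr_0 -[LHS]mulr_natr divfK//.
by rewrite pnatr_eq0 size_eq0.
Qed.

Lemma esum_weight_junk t :
  (\esum_(x in ~` letter `&` [set x | (t <= pickle x)%N /\ (t <= pickle (ginv x))%N])
     (weight x)%:E <= (2 * tiny t)%:E)%E.
Proof.
pose d n : R := tiny n - tiny n.+1.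
have d0 n : 0 <= d n by rewrite subr_ge0 ltW// tiny_gt.
have h : (\esum_(x in [set x : G | (t <= pickle x)%N]) (d (pickle x))%:E <=
    (tiny t)%:E)%E.
  rewrite -(@esum_image R G nat _ pickle (fun n => (d n)%:E)); last first.
    by move=> x y _ _; exact: (pcan_inj pickleK).
  apply: le_trans (esum_telescope t tiny_ge0 (fun n => ltW (tiny_gt n))).
  by apply: sub_esum => _ [x xt <-].
have hV : (\esum_(x in [set x : G | (t <= pickle (ginv x))%N])
    (d (pickle (ginv x)))%:E <= (tiny t)%:E)%E.
  rewrite -(@esum_image R G G _ ginv (fun x => (d (pickle x))%:E)); last first.
    by move=> x y _ _; exact: ginv_inj.
  by apply: le_trans h; apply: sub_esum => _ [x xt <-].
set A := _ `&` _.
have -> : (\esum_(x in A) (weight x)%:E =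
    \esum_(x in A) ((d (pickle x))%:E + (d (pickle (ginv x)))%:E))%E.
  by apply: eq_esum => x [nx _]; rewrite /weight; case: pselect.
rewrite esumD; [|by move=> *; rewrite lee_fin..].
rewrite mulr2n mulrDl mul1r EFinD leeD//.
  by apply: le_trans h; apply: sub_esum => x [_ []].
by apply: le_trans hV; apply: sub_esum => x [_ []].
Qed.

Lemma esum_weight_letters (A : set nat) :
  (\esum_(x in \bigcup_(t in A) [set` S t]) (weight x)%:E =
   \esum_(t in A) (harm t - harm t.+1)%:E)%E.
Proof.
rewrite esum_bigcupT.
- by apply: eq_esum => t _; exact: esum_weight_letter.
- by move=> t u _ _ [x [/= xt xu]]; exact: Sdisj xt xu.
- by move=> x; rewrite lee_fin ltW// weight_gt0.
Qed.

Definition total : R := fine (\esum_(x in [set: G]) (weight x)%:E).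

(** The mass of [S 0] alone is 1/2; the letters have mass at most [harm 0] = 1 and the other
    elements at most [2 * tiny 0]. Normalisation thus changes later estimates by a factor of at most
    2. *)
Lemma total_bounds : [/\ (\esum_(x in [set: G]) (weight x)%:E = total%:E)%E,
  2^-1 <= total & total <= 2].
Proof.
have w0 x : (0%R <= (weight x)%:E)%E by rewrite lee_fin ltW// weight_gt0.
have lb : ((2^-1)%:E <= \esum_(x in [set: G]) (weight x)%:E)%E.
  apply: le_trans (sub_esum _ (@subsetT _ [set` S 0])).
  rewrite esum_weight_letter lee_fin /harm; lra.
have ub : (\esum_(x in [set: G]) (weight x)%:E <= 2%:E)%E.
  rewrite (esumID letter)//.
  have -> : (2 : R)%:E = (1%:E + 1%:E)%E by rewrite -EFinD; congr (_%:E); lra.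
  rewrite leeD//.
    apply: le_trans (sub_esum _ (B := \bigcup_(t in setT) [set` S t]) _) _.
      by move=> x [_ [t xS]]; exists t.
    rewrite esum_weight_letters.
    have := @esum_telescope R harm 0 harm_ge0 (fun n => ltW (harm_gt n)).
    rewrite (_ : harm 0 = 1); last by rewrite /harm invr1.
    by apply: le_trans; apply: sub_esum.
  apply: le_trans (sub_esum _ _) (le_trans (esum_weight_junk 0) _).
    by move=> x [_ nx]; split.
  by rewrite lee_fin /tiny; lra.
have E : (\esum_(x in [set: G]) (weight x)%:E = total%:E)%E.
  rewrite /total fineK// fin_numElt (lt_le_trans _ lb) ?ltNyr//=.
  by rewrite (le_lt_trans ub)// ltry.
by split=> //; rewrite -lee_fin -E.
Qed.

Definition step (x : G) : R := weight x / total.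

Lemma total_gt0 : 0 < total.
Proof. by have [_ h _] := total_bounds; apply: lt_le_trans h; rewrite invr_gt0. Qed.

Lemma step_gt0 x : 0 < step x.
Proof. by rewrite divr_gt0 ?weight_gt0// total_gt0. Qed.

Lemma esum_step (A : set G) :
  (\esum_(x in A) (step x)%:E = (total^-1)%:E * \esum_(x in A) (weight x)%:E)%E.
Proof.
rewrite -esumZl.
- by apply: eq_esum => x _; rewrite -EFinM mulrC.
- by rewrite invr_ge0 ltW// total_gt0.
- by move=> x; rewrite lee_fin ltW// weight_gt0.
Qed.

Lemma step_prob : is_prob step.
Proof.
split=> [x|]; first by rewrite ltW// step_gt0.
have [h _ _] := total_bounds.
by rewrite esum_step h -EFinM mulVf// gt_eqF// total_gt0.
Qed.

Lemma esum_step_le (A : set G) (c : R) : 0 <= c ->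
  (\esum_(x in A) (weight x)%:E <= c%:E)%E ->
  (\esum_(x in A) (step x)%:E <= (2 * c)%:E)%E.
Proof.
move=> c0 Ac; have [_ h _] := total_bounds.
rewrite esum_step EFinM lee_pmul//.
- by rewrite lee_fin invr_ge0 ltW// total_gt0.
- by apply: esum_ge0 => x _; rewrite lee_fin ltW// weight_gt0.
- by rewrite lee_fin -[leRHS]invrK lef_pV2 ?posrE ?total_gt0 ?invr_gt0.
Qed.

Lemma esum_step_letter t :
  (\esum_(x in [set` S t]) (step x)%:E <= (2 * (harm t - harm t.+1))%:E)%E.
Proof.
apply: esum_step_le; last by rewrite esum_weight_letter.
by rewrite subr_ge0 ltW// harm_gt.
Qed.

Lemma esum_step_junk t :
  (\esum_(x in ~` letter `&` [set x | (t <= pickle x)%N /\ (t <= pickle (ginv x))%N])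
     (step x)%:E <= (4 * tiny t)%:E)%E.
Proof.
have -> : 4 * tiny t = 2 * (2 * tiny t) by lra.
apply: esum_step_le (esum_weight_junk t).
by rewrite mulr_ge0// tiny_ge0.
Qed.

Definition high t : set G := [set x | exists2 u, (t < u)%N & x \in S u].

Lemma esum_step_nhigh t :
  (\esum_(x in ~` high t) (step x)%:E <= (1 - (4 * t.+2%:R)^-1)%:E)%E.
Proof.
have [_ _ tb] := total_bounds.
have [_ p1] := step_prob.
have hi : (((4 * t.+2%:R)^-1)%:E <= \esum_(x in high t) (step x)%:E)%E.
  (* Finitely many types give the lower bound: the telescoping sum is 1/(t+2) - 1/(2t+4) =
     1/(2(t+2)), and [total] at most 2 turns this into 1/(4(t+2)). *)
  pose r := index_iota t.+1 (t + t).+3.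
  rewrite esum_step.
  have h : (((2 * t.+2%:R)^-1)%:E <= \esum_(x in high t) (weight x)%:E)%E.
    apply: (le_trans _ (sub_esum _ (A := \bigcup_(u in [set` r]) [set` S u]) _));
      last first.
      by move=> x [u /=]; rewrite mem_index_iota => /andP[tu _] xS; exists u.
    rewrite esum_weight_letters esum_seq ?iota_uniq//; last first.
      by move=> u; rewrite subr_ge0 ltW// harm_gt.
    have -> : \sum_(u <- r) (harm u - harm u.+1) = harm t.+1 - harm (t + t).+3.
      rewrite (telescope_sumr_eq (fun u => - harm u)) ?opprK 1?addrC//; first by lia.
      by move=> k _; rewrite opprK addrC.
    rewrite lee_fin /harm.
    have -> : (t + t).+4%:R = 2 * t.+2%:R :> R by rewrite -natrM; congr (_%:R); lia.
    have t2 : (t.+2%:R : R) != 0 by rewrite pnatr_eq0.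
    by rewrite le_eqVlt; apply/orP; left; apply/eqP; field.
  have -> : (4 * t.+2%:R)^-1 = 2^-1 * (2 * t.+2%:R)^-1 :> R.
    by rewrite -invfM mulrA; congr (_ * _)^-1; lra.
  rewrite EFinM lee_pmul// ?lee_fin ?invr_ge0 ?mulr_ge0//.
  by rewrite lef_pV2 ?posrE ?total_gt0.
have E : (\esum_(x in high t) (step x)%:E + \esum_(x in ~` high t) (step x)%:E
    = 1%:E)%E.
  rewrite -p1 [RHS](esumID (high t)) ?setTI// => x _.
  by rewrite lee_fin ltW// step_gt0.
by rewrite EFinB leeBrDr// -E addeC leeD.
Qed.

End StepMeasure.

(** * Harmonic functions *)

(* A letter above type [t], of probability about [1 / t], appears almost surely
   within [len t] steps; the invariance errors of [len t] steps must still add up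
   to something small, whence [quality]. *)
Definition len (t : nat) : nat := (t.+2 ^ 3)%N.
Definition quality (t : nat) : nat := (t.+2 ^ 4)%N.

Section Bounds.
Local Open Scope ring_scope.
Variable R : realType.

Lemma Bernoulli_pow (x : R) n : 0 <= x <= 1 -> (1 - x) ^+ n * (1 + n%:R * x) <= 1.
Proof.
move=> /andP[x0 x1]; elim: n => [|n IH]; first by rewrite expr0 mul0r addr0 mulr1.
apply: le_trans IH; rewrite exprSr -mulrA ler_wpM2l ?exprn_ge0 ?subr_ge0//.
have n0 : 0 <= n%:R :> R by [].
have : 0 <= n%:R * x * x by rewrite !mulr_ge0.
rewrite -natr1; nra.
Qed.

Definition keep (t : nat) : R := 1 - (4 * t.+2%:R)^-1.

Lemma keep_bounds t : 0 <= keep t <= 1.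
Proof.
have h : (1 : R) <= 4 * t.+2%:R by rewrite -natrM ler1n; lia.
rewrite /keep subr_ge0 gerBl invr_ge0 (le_trans _ h)// andbT.
by rewrite invf_le1// (lt_le_trans _ h).
Qed.

(** The exponent 3 in [len] is what makes this summable: Bernoulli's inequality bounds the power by
    1/(1 + n x) with n x = (t+2)^2/4. *)
Lemma keep_len t : keep t ^+ len t <= 4 / t.+2%:R ^+ 2.
Proof.
have t2 : (0 : R) < t.+2%:R by rewrite ltr0n.
set x : R := (4 * t.+2%:R)^-1.
have x0 : 0 < x by rewrite invr_gt0 mulr_gt0.
have xb : 0 <= x <= 1.
  rewrite ltW//= /x; have /andP[+ _] := keep_bounds t.
  by rewrite /keep subr_ge0.
have := @Bernoulli_pow x (len t) xb; rewrite -/x => h.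
rewrite /keep -/x ler_pdivlMr ?exprn_gt0//.
have e : (len t)%:R * x = t.+2%:R ^+ 2 / 4 :> R.
  rewrite /len natrX /x; move: t2; set T : R := t.+2%:R => t2.
  by field; rewrite gt_eqF.
have p0 : 0 <= (1 - x) ^+ len t by rewrite exprn_ge0// subr_ge0; case/andP: xb.
rewrite e in h; nra.
Qed.
End Bounds.

Section Words.
Local Open Scope cgroup_scope.
Variables (G : cgroup) (S : nat -> seq G).

Definition word (t j : nat) (y : G) := exists z : nat -> G,
  [/\ z 0%N = 1, z j = y & forall i, (i < j)%N -> low S t ((z i)^-1 * z i.+1)].

Lemma word_rcons t j y x : word t j y -> low S t x -> word t j.+1 (y * x).
Proof.
move=> [z [z0 zj zl]] xl; exists (fun i => if (i <= j)%N then z i else y * x).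
split=> //; first by rewrite ltnn.
move=> i; rewrite ltnS => ij; rewrite ij; case: ltnP => ij'; first exact: zl.
have -> : i = j by lia.
by rewrite zj gVK.
Qed.

Lemma word1 t x : low S t x -> word t 1 x.
Proof.
rewrite -{2}[x]gmul1; apply: word_rcons.
by exists (fun=> 1).
Qed.
End Words.

Section HarmonicConstant.
Local Open Scope classical_set_scope.
Local Open Scope ring_scope.
Variables (R : realType) (G : cgroup) (C : (G -> R) -> Prop).
Variables (S F : nat -> seq G).
Hypothesis ss : switching_sequence C (fun t => (len t).+2) quality S F.
Hypothesis CL : forall (y : G) H, C H -> C (fun x => H (gmul y x)).
Let nu := step R S.

Let uS t : uniq (S t). Proof. by case: ss => /(_ t)[]. Qed.
Let S0 t : S t != [::]. Proof. by case: ss => /(_ t)[]. Qed.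
Let Sdisj t u s : s \in S t -> s \in S u -> t = u.
Proof. exact: letters_disjoint ss _ _ _. Qed.
Let nu0 x : 0 <= nu x. Proof. exact/ltW/step_gt0. Qed.

Variable H : G -> R.
Hypotheses (CH : C H) (H01 : forall x, 0 <= H x <= 1).
Hypothesis Hharm : forall y,
  (H y)%:E = (\esum_(x in [set: G]) (nu x * H (gmul y x))%:E)%E.

Lemma word_F t j y : word S t j y -> (j <= (len t).+2)%N -> y \in F t.
Proof.
move=> [z [z0 <- zl]] jL; case: ss => _ _ _ _ [_ /(_ t j z jL zl)].
by rewrite z0 ginv1 gmul1.
Qed.

Lemma letter_average u y y' : y \in F u -> y' \in F u ->
  (\esum_(x in [set` S u]) (nu x * H (gmul y x))%:E <=
   \esum_(x in [set` S u]) (nu x * (H (gmul y' x) + 2 / (quality u)%:R))%:E)%E.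
Proof.
move=> yF yF'.
have [_ ai _ _ [FV _]] := ss.
have q0 : 0 < (quality u)%:R :> R by rewrite ltr0n expn_gt0.
have Hx0 z x : 0 <= H (gmul z x) by case/andP: (H01 (gmul z x)).
have p1 x : 0 <= nu x * H (gmul y x) by rewrite mulr_ge0.
have p2 x : 0 <= nu x * (H (gmul y' x) + 2 / (quality u)%:R).
  by rewrite mulr_ge0// addr_ge0// divr_ge0// ltW.
rewrite !esum_seq//.
have [c nuc] : exists c, forall x, x \in S u -> nu x = c.
    by eexists => x xS; rewrite /nu /step (weight_letter _ Sdisj xS).
  have c0 : 0 <= c.
    by case: (S u) (S0 u) nuc => // s r _ /(_ s (mem_head _ _)) <-.
  rewrite lee_fin big_seq [leRHS]big_seq.
  under eq_bigr => x xS do rewrite nuc//.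
  under [leRHS]eq_bigr => x xS do rewrite nuc//.
  rewrite -!big_seq -!mulr_sumr ler_wpM2l// big_split /=.
  rewrite big_const_seq count_predT iter_addr_0 -[_ *+ size _]mulr_natr.
  have h1 := ai u H CH H01 y yF.
  have H01' x : 0 <= H (gmul y' x) <= 1 by [].
  have /= := ai u _ (CL y' CH) H01' _ (FV _ _ yF').
  under eq_bigr do rewrite gKV.
  move=> h2; rewrite -(ler_pM2l q0) mulrDr.
  have -> : (quality u)%:R * (2 / (quality u)%:R * (size (S u))%:R) =
      2 * (size (S u))%:R :> R.
    by field; rewrite gt_eqF.
  lra.
Qed.

(** The loss per step: the averaging error for a letter above type [k], and the mass of the
    remaining elements of index at least [k], where only the bound 1 on [H] is used. *)
Let delta k : R := 2 / (quality k)%:R + 4 * tiny R k.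

(* Compare two walks with equal increments: a letter above type [k] averages the
   difference out, and while only low letters occur the induction goes on. *)
Lemma harmonic_gap k m j y y' : (j + m <= (len k.+1).+2)%N ->
  word S k.+1 j y -> word S k.+1 j y' ->
  H y <= H y' + (m%:R * delta k + keep R k ^+ m).
Proof.
have /andP[r0 r1] := keep_bounds R k.
have d0 : 0 <= delta k by rewrite addr_ge0 ?divr_ge0 ?mulr_ge0 ?tiny_ge0.
elim: m j y y' => [|m IH] j y y' jm wy wy'.
  rewrite mul0r add0r expr0.
  by have /andP[_ h] := H01 y; have /andP[h' _] := H01 y'; lra.
set b := m%:R * delta k + keep R k ^+ m.
have b0 : 0 <= b by rewrite addr_ge0 ?mulr_ge0 ?exprn_ge0.
(* Being high at [k] and low at [k.+1] cover all letters, so [J] consists of elements that are no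
   letters and have large index. *)
pose Hi := high S k; pose J : set G := ~` Hi `&` ~` low S k.+1.
have Hx0 z x : 0 <= H (gmul z x) by case/andP: (H01 (gmul z x)).
have q0 : 0 <= 2 / (quality k)%:R :> R by rewrite divr_ge0.
have yF u : (k < u)%N -> y \in F u /\ y' \in F u.
  move=> ku; split; apply: (F_mono ss ku).
    by apply: word_F wy _; lia.
  by apply: word_F wy' _; lia.
have E1 : (\esum_(x in Hi) (nu x * H (gmul y x))%:E <=
    \esum_(x in Hi) (nu x * (H (gmul y' x) + 2 / (quality k)%:R))%:E)%E.
  have -> : Hi = \bigcup_(u in [set u | (k < u)%N]) [set` S u].
    by apply/seteqP; split=> x [u ku xS]; exists u.
  have tS : trivIset setT (fun u => [set` S u]).
    by move=> t u _ _ [x [/= xt xu]]; exact: Sdisj xt xu.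
  rewrite !esum_bigcupT//; first last.
  - by move=> x; rewrite lee_fin mulr_ge0.
  - by move=> x; rewrite lee_fin; apply: mulr_ge0 => //; apply: addr_ge0.
  apply: le_esum => u /= ku; have [yu yu'] := yF _ ku.
  apply: le_trans (letter_average yu yu') _; apply: le_esum => x _.
  rewrite lee_fin ler_wpM2l// lerD2l ler_wpM2l// lef_pV2 ?posrE ?ltr0n ?expn_gt0//.
  by rewrite ler_nat /quality leq_exp2r//; lia.
have E2 : (\esum_(x in ~` Hi) (nu x * H (gmul y x))%:E <=
    \esum_(x in ~` Hi) ((nu x * H (gmul y' x))%:E + (nu x * b)%:E)
    + \esum_(x in ~` Hi) (nu x * (x \in J)%:R)%:E)%E.
  rewrite -esumD; first last.
  - by move=> x _; rewrite lee_fin; apply: mulr_ge0.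
  - by move=> x _; rewrite -EFinD lee_fin; apply: addr_ge0; apply: mulr_ge0.
  apply: le_esum => x nHi; rewrite -!EFinD lee_fin -!mulrDr ler_wpM2l//.
  have [xl|nxl] := pselect (low S k.+1 x).
    apply: le_trans (_ : H (gmul y' x) + b <= _); last by rewrite lerDl.
    by apply: (IH j.+1); [lia|exact: word_rcons|exact: word_rcons].
  have -> : x \in J by rewrite inE.
  have /andP[_ h] := H01 (gmul y x); apply: le_trans h _.
  by rewrite lerDr addr_ge0.
have EJ : (\esum_(x in ~` Hi) (nu x * (x \in J)%:R)%:E <= (4 * tiny R k)%:E)%E.
  apply: le_trans (@esum_step_junk R G S uS S0 Sdisj k).
  rewrite [leRHS]esum_mkcond [leLHS]esum_mkcond; apply: le_esum => x _.
  case: ifPn => [xHi|_]; last by case: ifP => // _; rewrite lee_fin.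
  case: ifPn => [_|].
    by rewrite lee_fin ler_piMr// lern1 leq_b1.
  have [xJ|_] := boolP (x \in J); last by rewrite mulr0.
  rewrite notin_setE => /= nx; exfalso; apply: nx.
  move: xJ; rewrite inE => -[nHi nl]; split.
    move=> [t xS]; have [kt|tk] := ltnP k t; first by apply: nHi; exists t.
    by apply: nl; left; exists t.
  split; rewrite leqNgt; apply/negP => h; apply: nl; right.
    by left; exact: ltnW.
  by right; exact: ltnW.
have Eb : (\esum_(x in ~` Hi) (nu x * b)%:E <= (b * keep R k)%:E)%E.
  under eq_esum do rewrite mulrC EFinM.
  rewrite esumZl// EFinM lee_wpmul2l ?lee_fin//.
  exact: esum_step_nhigh.
have Eq : (\esum_(x in Hi) (nu x * (2 / (quality k)%:R))%:E <= (2 / (quality k)%:R)%:E)%E.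
  under eq_esum do rewrite mulrC EFinM.
  rewrite esumZl// -[leRHS]mule1 lee_wpmul2l ?lee_fin//.
  have [_ <-] := @step_prob R G S uS S0 Sdisj.
  exact: sub_esum.
have fin0 z : (0%R <= (nu z)%:E)%E by rewrite lee_fin.
have : ((H y)%:E <= (H y' + (2 / (quality k)%:R + (b * keep R k + 4 * tiny R k)))%:E)%E.
  rewrite Hharm (esumID Hi); last by move=> x _; rewrite lee_fin; apply: mulr_ge0.
  rewrite !setTI.
  apply: le_trans (leeD E1 E2) _.
  rewrite esumD; [|by move=> x _; rewrite lee_fin; apply: mulr_ge0..].
  under eq_esum do rewrite mulrDr EFinD.
  rewrite esumD; [|by move=> x _; rewrite lee_fin; apply: mulr_ge0..].
  rewrite EFinD Hharm [X in (_ <= X + _)%E](esumID Hi); last first.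
    by move=> x _; rewrite lee_fin; apply: mulr_ge0.
  rewrite !setTI -[X in (_ + X <= _)%E]addeA addeACA; apply: leeD => //.
  by rewrite EFinD; apply: leeD => //; rewrite EFinD; apply: leeD.
rewrite lee_fin => /le_trans; apply; rewrite lerD2l -natr1 mulrDl mul1r exprSr.
have -> : b * keep R k = m%:R * delta k * keep R k + keep R k ^+ m * keep R k.
  by rewrite -mulrDl.
have h : m%:R * delta k * keep R k <= m%:R * delta k by rewrite ler_piMr// mulr_ge0.
have dE : delta k = 2 / (quality k)%:R + 4 * tiny R k by [].
lra.
Qed.

(** For [k] beyond their indices, [y] and [y'] are themselves words of length 1, and [harmonic_gap]
    applies with [len k] steps. With T = k+2 its bound is at most 2/T + 4/T^2 + 4/T^2, hence at most
    10/T, and [k] is arbitrarily large. *)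
Lemma harmonic_le y y' : H y <= H y'.
Proof.
rewrite -subr_le0 leNgt; apply/negP => d0.
set d := H y - H y' in d0.
have [n nd] : exists n : nat, 10 / d < n%:R.
  exists (Num.bound (10 / d)); apply: archi_boundP.
  by rewrite divr_ge0// ltW.
pose k := (n + pickle y + pickle y')%N.
have wy x : (pickle x <= k)%N -> word S k.+1 1 x.
  by move=> xk; apply: word1; right; left.
have lenS : (1 + len k <= (len k.+1).+2)%N.
  have : (len k <= len k.+1)%N by rewrite /len leq_exp2r.
  lia.
have := harmonic_gap lenS (wy y _) (wy y' _).
move=> /(_ _ _)h; have {}h : H y <= H y' + ((len k)%:R * delta k + keep R k ^+ len k).
  by apply: h; rewrite /k; lia.
set T : R := k.+2%:R.
have T0 : 0 < T by rewrite ltr0n.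
have T1 : 1 <= T by rewrite ler1n.
have e1 : (len k)%:R * delta k = 2 / T + 4 / T ^+ 2.
  rewrite /delta /quality /tiny /len !natrX -/T.
  by field; rewrite gt_eqF.
have e2 := keep_len R k.
have e3 : (T ^+ 2)^-1 <= T^-1.
  by rewrite lef_pV2 ?posrE ?exprn_gt0// expr2 ler_pMl.
have : d <= 10 / T.
  rewrite -/T in e2; rewrite e1 in h.
  move: h e2 e3; rewrite /d; move: (keep R k ^+ len k) (T ^+ 2)^-1 T^-1 (H y) (H y').
  by move=> *; lra.
have kT : n%:R < T by rewrite ltr_nat /k; lia.
rewrite ler_pdivlMr// => dT.
have : 10 < n%:R * d by rewrite -ltr_pdivrMr.
nra.
Qed.


End HarmonicConstant.

(** * Trivial boundaries of quotients *)

Section Quotient.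
Local Open Scope classical_set_scope.
Local Open Scope ring_scope.
Variables (R : realType) (G G' : cgroup) (C : (G -> R) -> Prop).
Variables (S F : nat -> seq G).
Hypothesis ss : switching_sequence C (fun t => (len t).+2) quality S F.
Hypothesis CL : forall (y : G) H, C H -> C (fun x => H (gmul y x)).
Variables (pi : G -> G') (nu' : G' -> R).
Hypotheses (piM : forall x y, pi (gmul x y) = gmul (pi x) (pi y))
  (pi_surj : forall a, exists x, pi x = a)
  (Cpi : forall f : G' -> R, C (f \o pi)).
Hypothesis nu'E : forall a,
  (nu' a)%:E = (\esum_(x in pi @^-1` [set a]) (step R S x)%:E)%E.

(** The harmonic function of an invariant event on [G'] lifts along [pi] to a harmonic function for
    [step]: sum over the fibres of [pi] first. The lift is constant by [harmonic_le], used in both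
    directions. *)
Lemma quotient_trivial : poisson_trivial nu'.
Proof.
move=> P Plaw; apply: (constant_harmonic_trivial Plaw) => A iA z.
have uS t : uniq (S t) by case: ss => /(_ t)[].
have S0 t : S t != [::] by case: ss => /(_ t)[].
have Sdisj t u s : s \in S t -> s \in S u -> t = u.
  exact: (letters_disjoint ss).
have nu0 x : 0 <= step R S x by exact/ltW/step_gt0.
pose f a := fine (P (gact a @^-1` A)).
have mA a : measurable (gact (G := G') a @^-1` A).
  by apply: measurable_gact_pre; case: iA.
have fE a : P (gact a @^-1` A) = (f a)%:E by rewrite fineK// fin_num_measure.
have f01 a : 0 <= f a <= 1.
  by rewrite -!lee_fin -fE measure_ge0 probability_le1.
have [x <-] := pi_surj z; have [e <-] := pi_surj gone.
have Hharm y : ((f \o pi) y)%:E =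
    (\esum_(x in [set: G]) (step R S x * (f \o pi) (gmul y x))%:E)%E.
  rewrite /= -fE (harmonic_invariant Plaw)//.
  rewrite [RHS](esum_fibers pi); last first.
    by move=> t; rewrite lee_fin; apply: mulr_ge0 => //; case/andP: (f01 (pi (gmul y t))).
  apply: eq_esum => a _; rewrite fE muleC nu'E -esumZl; first last.
  - by move=> t; rewrite lee_fin.
  - by case/andP: (f01 (gmul (pi y) a)).
  by apply: eq_esum => t /= ta; rewrite -EFinM mulrC piM ta.
have H01 t : 0 <= (f \o pi) t <= 1 by exact: f01.
have le := harmonic_le ss CL (Cpi f) H01 Hharm.
by rewrite !fE; congr (_%:E); apply/eqP; rewrite eq_le !le.
Qed.
End Quotient.

Section Marginals.
Local Open Scope classical_set_scope.
Local Open Scope ring_scope.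
Variables (R : realType) (G1 G2 : cgroup).
Let G := prod_cgroup G1 G2.
Variables (nu : G -> R).
Hypothesis pnu : is_prob nu.

Lemma esum_prob_fin (A : set G) :
  (fine (\esum_(x in A) (nu x)%:E))%:E = (\esum_(x in A) (nu x)%:E)%E.
Proof.
have [nu0 nu1] := pnu.
rewrite fineK// fin_numElt (lt_le_trans (ltNyr 0))/=; last first.
  by apply: esum_ge0 => x _; rewrite lee_fin.
apply: le_lt_trans (ltry 1); rewrite -nu1; exact: sub_esum.
Qed.

Lemma pr1_measE a :
  (pr1_meas nu a)%:E = (\esum_(x in (fun x : G => x.1) @^-1` [set a]) (nu x)%:E)%E.
Proof.
have -> : (fun x : G => x.1) @^-1` [set a] = (fun b => (a, b) : G) @` [set: gcar G2].
  apply/seteqP; split=> [[a' b] /= ->|_ [b _ <-]//]; by exists b.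
rewrite -esum_prob_fin /pr1_meas esum_image//.
by move=> b b' _ _ [].
Qed.

Lemma pr2_measE b :
  (pr2_meas nu b)%:E = (\esum_(x in (fun x : G => x.2) @^-1` [set b]) (nu x)%:E)%E.
Proof.
have -> : (fun x : G => x.2) @^-1` [set b] = (fun a => (a, b) : G) @` [set: gcar G1].
  apply/seteqP; split=> [[a b'] /= ->|_ [a _ <-]//]; by exists a.
rewrite -esum_prob_fin /pr2_meas esum_image//.
by move=> a a' _ _ [].
Qed.
End Marginals.

(** * Records *)

Section Records.
Local Open Scope classical_set_scope.
Variables (R : realType) (G : cgroup) (C : (G -> R) -> Prop).
Variables (S F : nat -> seq G).
Hypothesis ss : switching_sequence C (fun t => (len t).+2) quality S F.

Let Sdisj t u s : s \in S t -> s \in S u -> t = u.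
Proof. exact: letters_disjoint ss _ _ _. Qed.

Definition record (w : nat -> G) (n t i : nat) :=
  [/\ (i <= n)%N, (n < len t)%N, increment w i \in S t &
   forall j, (j <= n)%N -> j != i -> low S t (increment w j)].

(** A letter may be low because of its index. It then lies in [F t], hence in [F u] if [t <= u], and
    [S u] avoids that set. *)
Lemma low_letter t u s : low S t s -> s \in S u -> (u < t)%N.
Proof.
move=> sl sS; case: (sl) => [[j jt sj]|h]; first by rewrite (Sdisj sS sj).
rewrite ltnNge; apply/negP => tu.
have /negP := letter_notin_F ss sS; apply; apply: (F_mono ss tu).
exact: (low_F ss).
Qed.

(** [w k] is the position after k+1 steps; the index is moved so that the starting point is position
    0. *)
Definition position (w : nat -> G) (n : nat) : G := if n is n'.+1 then w n' else gone.

Lemma incrementE w n :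
  increment w n = gmul (ginv (position w n)) (position w n.+1).
Proof. by case: n => [|n] //=; rewrite ginv1 gmul1. Qed.

Lemma record_F w n t i h : record w n t i -> low S t h ->
  gmul h (position w i) \in F t /\
  gmul (ginv (position w i.+1)) (position w n.+1) \in F t.
Proof.
move=> [ik nl iS lo] hl.
have [_ _ _ _ [_ wF]] := ss.
split.
  (* Starting the path at the inverse of [h] makes [h] one more low increment. *)
  have := wF t i.+1 (fun k => if k is k'.+1 then position w k' else ginv h).
  rewrite ginvK; apply; first by rewrite ltnW// ltnS; lia.
  move=> [|k] ki; first by rewrite ginvK gmulr1.
  by rewrite -incrementE; apply: lo; lia.
have := wF t (n - i)%N (fun k => position w (i.+1 + k)%N).
rewrite addn0 (_ : (i.+1 + (n - i))%N = n.+1); last by lia.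
apply; first by lia.
by move=> k kn; rewrite addnS -incrementE; apply: lo; lia.
Qed.

(** [y] is the position just before the record letter of time [N], and [K] is the type of that
    letter; neither depends on [h]. At a later time the record letter is either still this one, a
    single step from the root, or it was read after time [N] and has larger type. In the second case
    the induction hypothesis applies to the position before it. *)
Lemma eventually_tree w N a :
  (forall n, (N <= n)%N -> exists t i, record w n t i /\ (a <= t)%N) ->
  exists K y, forall h, (pickle h < a)%N ->
    gmul h y \in F K /\
    forall n, (N <= n)%N -> tree S F K (gmul h y) (gmul h (w n)).
Proof.
move=> good.
have [K [m [rK aK]]] := good N (leqnn N).
have [mN NK mS lo] := rK.
exists K, (position w m) => h ha.
have lowh t : (a <= t)%N -> low S t h.
  by move=> at_; right; left; exact: leq_trans at_.
have [hyF _] := record_F rK (lowh _ aK).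
split=> // n; elim/ltn_ind: n => n IH Nn.
have [t [i [rt at_]]] := good n Nn.
have [iN nt iS lot] := rt.
have [hzF vF] := record_F rt (lowh _ at_).
have wE : gmul h (w n) = gmul (gmul (gmul h (position w i)) (increment w i))
    (gmul (ginv (position w i.+1)) (position w n.+1)).
  by rewrite incrementE; gsimp.
rewrite wE.
have [im|im] := eqVneq i m.
  subst i; have tK := Sdisj iS mS; subst t.
  by apply: (@tree_step _ _ _ _ _ K) => //; exact: tree_root.
have Kt : (K < t)%N.
  by apply: low_letter mS; apply: lot; [exact: leq_trans Nn|rewrite eq_sym].
apply: (@tree_step _ _ _ _ _ t) => //; last exact: ltnW.
have Ni : (N < i)%N.
  rewrite ltnNge; apply/negP => iN'.
  by have := low_letter (lo _ iN' im) iS; rewrite ltnNge (ltnW Kt).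
case: i Ni iN {rt iS lot hzF vF wE im} => // i Ni iN.
by apply: IH; lia.
Qed.

Definition no_progress t : set (nat -> G) :=
  increments_in (len t) (fun=> ~` high S t).
(** Counting all pairs of letters of type [t] within [len t] steps would be far too wasteful.
    Demanding that nothing above [t] was read by time j contributes the factor [keep R t] to the
    power j-1, so that only times j of order [t] matter. *)
Definition tie t : set (nat -> G) :=
  [set w | exists j, (j < len t)%N /\ exists i, (i < j)%N /\
    increments_in j.+1
      (fun l => if (l == i) || (l == j) then [set` S t] else ~` high S t) w].
Definition long_junk t : set (nat -> G) :=
  [set w | exists i, (i < len t)%N /\
    increments_in i.+1
      (fun l => if l == i then ~` letter S `&`
         [set x | (t <= pickle x)%N /\ (t <= pickle (ginv x))%N] else setT) w].

(** Let [t] be the largest type read up to time [n]. Progress at [a] gives [a <= t], progress at [t]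
    gives [n < len t], the absence of ties makes the letter unique, and the absence of long junk
    makes all other elements low. *)
Lemma typical_record w T a : (T <= a)%N ->
  (forall t, (T <= t)%N -> ~ (no_progress t w \/ tie t w \/ long_junk t w)) ->
  forall n, (len a <= n)%N -> exists t i, record w n t i /\ (a <= t)%N.
Proof.
move=> Ta typ n an.
have prog t m : (T <= t)%N -> (len t <= m)%N ->
    exists i u, [/\ (i < m)%N, (t < u)%N & increment w i \in S u].
  move=> Tt tm; apply: contrapT => h; apply: (typ t Tt); left => i ik.
  by move=> [u tu uS]; apply: h; exists i, u; split=> //; lia.
pose p t := `[< exists2 i, (i <= n)%N & increment w i \in S t >].
have [i0 [u0 [i0n au0 u0S]]] := prog a n Ta an.
have exp : exists t, p t by exists u0; apply/asboolP; exists i0 => //; exact: ltnW.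
have [M pM] : exists M, forall t, p t -> (t <= M)%N.
  suff [M MP] : exists M, forall i, (i < n.+1)%N ->
      forall t, increment w i \in S t -> (t <= M)%N.
    by exists M => t /asboolP[i ik]; exact: MP.
  elim: n.+1 => [|k [M IH]]; first by exists 0%N.
  have [[u uS]|nu] := pselect (exists u, increment w k \in S u).
    exists (maxn M u) => i; rewrite ltnS leq_eqVlt => /predU1P[->|ik] t tS.
      by rewrite (Sdisj tS uS) leq_maxr.
    by rewrite (leq_trans (IH _ ik _ tS))// leq_maxl.
  exists M => i; rewrite ltnS leq_eqVlt => /predU1P[->|ik] t tS; last exact: IH tS.
  by exfalso; apply: nu; exists t.
have [t /asboolP[i ik iS] tmax] := ex_maxnP exp pM.
have {}tmax j u : (j <= n)%N -> increment w j \in S u -> (u <= t)%N.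
  by move=> jn uS; apply: tmax; apply/asboolP; exists j.
have at_ : (a <= t)%N by apply/ltnW/(leq_trans au0)/(tmax i0); rewrite // ltnW.
have Tt : (T <= t)%N by exact: leq_trans at_.
have nt : (n < len t)%N.
  rewrite ltnNge; apply/negP => tn.
  have [j [u [jn tu uS]]] := prog t n Tt tn.
  by have := tmax j u (ltnW jn) uS; rewrite leqNgt tu.
exists t, i; split=> //; split=> // j jn ji.
have [[u uS]|nl] := pselect (letter S (increment w j)).
  left; exists u => //; rewrite ltn_neqAle (tmax j u jn uS) andbT.
  apply/eqP => ut; subst u; apply: (typ t Tt); right; left.
  have tie_lt k l : (k < l)%N -> (l <= n)%N -> increment w k \in S t ->
      increment w l \in S t -> tie t w.
    move=> kl ln kS lS; exists l; split; first exact: leq_ltn_trans nt.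
    exists k; split=> // q ql; case: ifPn => [/orP[/eqP ->|/eqP ->] //|_].
    have qn : (q <= n)%N by lia.
    by move=> [u tu uS']; have := tmax q u qn uS'; rewrite leqNgt tu.
  have [ij|ij|ij] := ltngtP i j; [exact: (tie_lt i j)|exact: (tie_lt j i)|].
  by rewrite ij eqxx in ji.
apply: contrapT => nlo; apply: (typ t Tt); right; right.
exists j; split; first exact: leq_ltn_trans nt.
move=> l lj; case: eqP => [->|//]; split=> //=.
by split; rewrite leqNgt; apply/negP => h; apply: nlo; right; [left|right].
Qed.
End Records.

(** * Borel-Cantelli estimates for atypical types *)

Section Rare.
Local Open Scope classical_set_scope.
Local Open Scope ring_scope.
Context d (T : measurableType d) (R : realType) (P : {measure set T -> \bar R}).

Definition rare (A : set T) (c : R) := measurable A /\ (P A <= c%:E)%E.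

Lemma rareU A B c e : rare A c -> rare B e -> rare (A `|` B) (c + e).
Proof.
move=> [mA Ac] [mB Be]; split; first exact: measurableU.
by apply: le_trans (measureU2 _ mA mB) _; rewrite EFinD leeD.
Qed.

Lemma rare_exists n (E : nat -> set T) (c : nat -> R) :
  (forall i, (i < n)%N -> rare (E i) (c i)) ->
  rare [set w | exists i, (i < n)%N /\ E i w] (\sum_(i < n) c i).
Proof.
elim: n => [|n IH] Ec.
  rewrite big_ord0 (_ : [set w | _] = set0); last by apply/seteqP; split=> // w [i []].
  by split; [exact: measurable0|rewrite measure0 lee_fin].
rewrite big_ord_recr /=.
rewrite (_ : [set w | _] = [set w | exists i, (i < n)%N /\ E i w] `|` E n).
  by apply: rareU; [apply: IH => i ik; apply: Ec; exact: ltnW|exact: Ec].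
apply/seteqP; split=> w /=.
  move=> [i []]; rewrite ltnS leq_eqVlt => /predU1P[->|ik] Ei; first by right.
  by left; exists i.
by move=> [[i [ik Ei]]|En]; [exists i; split=> //; exact: ltnW|exists n].
Qed.
End Rare.

Section SeriesBounds.
Local Open Scope ring_scope.
Variable R : realType.

(** Partial sums of the derivative of the geometric series, through an exact identity free of
    division. *)
Lemma arith_geom_le (r : R) n : 0 <= r <= 1 ->
  (1 - r) ^+ 2 * \sum_(j < n) j%:R * r ^+ j.-1 <= 1.
Proof.
move=> /andP[r0 r1]; case: n => [|n]; first by rewrite big_ord0 mulr0.
suff E : (1 - r) ^+ 2 * \sum_(j < n.+1) j%:R * r ^+ j.-1 + n.+1%:R * r ^+ n =
    1 + n%:R * r ^+ n.+1.
  have h : n%:R * r ^+ n.+1 <= n.+1%:R * r ^+ n.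
    rewrite exprS mulrCA; have n0 : 0 <= n%:R :> R by [].
    have rn : 0 <= r ^+ n by rewrite exprn_ge0.
    have : 0 <= n%:R * r ^+ n by rewrite mulr_ge0.
    rewrite -natr1; nra.
  lra.
elim: n => [|n IH]; first by rewrite big_ord_recr big_ord0 /= expr0; ring.
rewrite big_ord_recr /= mulrDr; move: IH.
move: (\sum_(j < n.+1) _) => s IH.
rewrite -!natr1 !exprS in IH *.
nra.
Qed.

Lemma prod_two (a r : R) (i j : nat) : (i < j)%N ->
  \prod_(l < j.+1) (if (l == i :> nat) || (l == j :> nat) then a else r) =
  a ^+ 2 * r ^+ j.-1.
Proof.
move=> ij; rewrite big_ord_recr /= eqxx orbT (bigD1 (Ordinal ij)) //= eqxx /=.
rewrite (eq_bigr (fun=> r)); last first.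
  move=> l /negP li; case: eqP => [e|_]; first by case: li; apply/eqP/val_inj.
  by rewrite (ltn_eqF (ltn_ord l)).
rewrite prodr_const cardC1 card_ord; ring.
Qed.
End SeriesBounds.

Section Atypical.
Local Open Scope classical_set_scope.
Local Open Scope ring_scope.
Variables (R : realType) (G : cgroup) (C : (G -> R) -> Prop).
Variables (S F : nat -> seq G).
Hypothesis ss : switching_sequence C (fun t => (len t).+2) quality S F.
Let nu := step R S.
Variable P : probability (Paths G) R.
Hypothesis Plaw : rw_law nu P.

Let uS t : uniq (S t). Proof. by case: ss => /(_ t)[]. Qed.
Let S0 t : S t != [::]. Proof. by case: ss => /(_ t)[]. Qed.
Let Sdisj t u s : s \in S t -> s \in S u -> t = u.
Proof. exact: letters_disjoint ss _ _ _. Qed.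

Lemma increments_in_rare n (D : nat -> set G) (c : nat -> R) :
  (forall i, (i < n)%N -> 0 <= c i) ->
  (forall i, (i < n)%N -> (\esum_(x in D i) (nu x)%:E <= (c i)%:E)%E) ->
  rare P (increments_in n D) (\prod_(i < n) c i).
Proof.
move=> c0 Dc; split; first exact: measurable_increments_in.
exact: (increments_in_le Plaw).
Qed.

Lemma no_progress_rare t : rare P (no_progress S t) (keep R t ^+ len t).
Proof.
have /andP[k0 _] := keep_bounds R t.
have := @increments_in_rare (len t) (fun=> ~` high S t) (fun=> keep R t).
rewrite prodr_const card_ord => h; apply: h => // i _.
exact: esum_step_nhigh.
Qed.

Lemma tie_rare t : rare P (tie S t)
  (\sum_(j < len t) \sum_(i < j)
     ((2 * (harm R t - harm R t.+1)) ^+ 2 * keep R t ^+ j.-1)).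
Proof.
have /andP[k0 _] := keep_bounds R t.
set a := 2 * _.
apply: (rare_exists (c := fun j => \sum_(i < j) (a ^+ 2 * keep R t ^+ j.-1))) => j jl.
apply: (rare_exists (c := fun=> a ^+ 2 * keep R t ^+ j.-1)) => i ij.
rewrite -(prod_two _ _ ij).
apply: (@increments_in_rare j.+1 _
  (fun l => if (l == i) || (l == j) then a else keep R t)).
  move=> l _; case: ifP => // _.
  by rewrite mulr_ge0// subr_ge0 ltW// harm_gt.
move=> l _; case: ifP => _; last exact: esum_step_nhigh.
exact: esum_step_letter.
Qed.

Lemma long_junk_rare t : rare P (long_junk S t) (\sum_(i < len t) (4 * tiny R t)).
Proof.
have t0 : 0 <= 4 * tiny R t by rewrite mulr_ge0// tiny_ge0.
apply: (rare_exists (c := fun=> 4 * tiny R t)) => i il.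
have -> : 4 * tiny R t = \prod_(l < i.+1) (if (l == i :> nat) then 4 * tiny R t else 1).
  rewrite big_ord_recr /= eqxx big1 ?mul1r// => l _.
  by rewrite (ltn_eqF (ltn_ord l)).
apply: (@increments_in_rare i.+1 _ (fun l => if l == i then 4 * tiny R t else 1)).
  by move=> l _; case: ifP.
move=> l _; case: ifP => _; first exact: esum_step_junk.
by have [_ ->] := @step_prob R G S uS S0 Sdisj.
Qed.

Definition atypical t : set (Paths G) :=
  no_progress S t `|` (tie S t `|` long_junk S t).

(** All three probabilities are O(t^-2). Measured against the harmonic difference 1/((t+1)(t+2)),
    whose series telescopes, they contribute at most 4, 128 and 4. *)
Lemma atypical_rare t : rare P (atypical t) (144 * (harm R t - harm R t.+1)).
Proof.
have [m le] := rareU (no_progress_rare t) (rareU (tie_rare t) (long_junk_rare t)).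
split=> //; apply: le_trans le _; rewrite lee_fin.
set T : R := t.+1%:R.
have T1 : 1 <= T by rewrite ler1n.
have T2 : t.+2%:R = T + 1 :> R by rewrite /T natr1.
have hE : harm R t - harm R t.+1 = (T * (T + 1))^-1.
  rewrite /harm T2 -/T; field; rewrite !gt_eqF; lra.
have e1 : keep R t ^+ len t <= 4 / (T + 1) ^+ 2 by rewrite -T2; exact: keep_len.
have e3 : \sum_(i < len t) (4 * tiny R t) = 4 / (T + 1) ^+ 2.
  rewrite sumr_const card_ord -[_ *+ _]mulr_natl /len /tiny natrX T2.
  field; rewrite !gt_eqF; lra.
have e2 : \sum_(j < len t) \sum_(i < j)
    ((2 * (harm R t - harm R t.+1)) ^+ 2 * keep R t ^+ j.-1) <= 64 / T ^+ 2.
  have -> : \sum_(j < len t) \sum_(i < j)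
    ((2 * (harm R t - harm R t.+1)) ^+ 2 * keep R t ^+ j.-1) =
     (64 / T ^+ 2) * ((1 - keep R t) ^+ 2 * \sum_(j < len t) j%:R * keep R t ^+ j.-1).
    rewrite !mulr_sumr; apply: eq_bigr => j _.
    rewrite sumr_const card_ord -[LHS]mulr_natl.
    have -> : 1 - keep R t = (4 * (T + 1))^-1 by rewrite /keep T2; ring.
    rewrite hE; move: (keep R t ^+ _) j%:R => x y.
    field; rewrite !gt_eqF; lra.
  rewrite ler_piMr//; first by rewrite divr_ge0// exprn_ge0; lra.
  exact/arith_geom_le/keep_bounds.
rewrite e3; apply: le_trans (lerD e1 (lerD e2 (lexx _))) _; rewrite hE.
have -> : 4 / (T + 1) ^+ 2 = (T * (T + 1))^-1 * (4 * T / (T + 1)).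
  field; rewrite !gt_eqF; lra.
have -> : 64 / T ^+ 2 = (T * (T + 1))^-1 * (64 * (T + 1) / T).
  field; rewrite !gt_eqF; lra.
rewrite -!mulrDr [leRHS]mulrC ler_wpM2l//; first by rewrite invr_ge0; nra.
have b1 : 4 * T / (T + 1) <= 4 by rewrite ler_pdivrMr; lra.
have b2 : 64 * (T + 1) / T <= 128 by rewrite ler_pdivrMr; lra.
by apply: le_trans (lerD b1 (lerD b2 b1)) _; lra.
Qed.

Lemma atypical_finitely_often : P (lim_sup_set atypical) = 0%E.
Proof.
apply: lim_sup_set_cvg0 => [t|]; first by case: (atypical_rare t).
apply: (@le_lt_trans _ _ (144 * harm R 0)%:E); last exact: ltry.
have h0 t : 0 <= harm R t - harm R t.+1 by rewrite subr_ge0 ltW// harm_gt.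
apply: (@le_trans _ _ (\sum_(t <oo) (144 * (harm R t - harm R t.+1))%:E)%E).
  by apply: lee_nneseries => t _ //; case: (atypical_rare t).
rewrite nneseries_esumT; last by move=> t; rewrite lee_fin mulr_ge0.
under eq_esum do rewrite EFinM.
rewrite esumZl// EFinM lee_wpmul2l ?lee_fin//.
have := @esum_telescope R (harm R) 0 (harm_ge0 R) (fun n => ltW (harm_gt R n)).
by apply: le_trans; apply: sub_esum.
Qed.

End Atypical.

(** * Essential freeness *)

Section Freeness.
Local Open Scope classical_set_scope.
Local Open Scope ring_scope.

Lemma null_cover d (T : measurableType d) (R : realType)
    (P : {measure set T -> \bar R}) (U : countType) (A : set T) (F : U -> set T) :
  measurable A -> (forall x, measurable (F x)) -> (forall x, P (F x) = 0%E) ->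
  A `<=` \bigcup_x F x -> P A = 0%E.
Proof.
move=> mA mF F0 AF.
pose H n := if unpickle n is Some x then F x else set0 : set T.
have mH n : measurable (H n) by rewrite /H; case: unpickle.
apply/eqP; rewrite eq_le measure_ge0 andbT.
apply: le_trans (measure_sigma_subadditive P mH mA _) _.
  by move=> w /AF[x _ Fx]; exists (pickle x) => //; rewrite /H pickleK.
by rewrite eseries0// => n _ _; rewrite /H; case: unpickle => [x|]; rewrite ?measure0.
Qed.

Section TreeEvent.
Variables (R : realType) (G : cgroup) (C : (G -> R) -> Prop).
Variables (S F : nat -> seq G).
Hypothesis ss : switching_sequence C (fun t => (len t).+2) quality S F.
Let nu := step R S.

Let uS t : uniq (S t). Proof. by case: ss => /(_ t)[]. Qed.
Let S0 t : S t != [::]. Proof. by case: ss => /(_ t)[]. Qed.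
Let Sdisj t u s : s \in S t -> s \in S u -> t = u.
Proof. exact: letters_disjoint ss _ _ _. Qed.

Definition tree_event K y : set (Paths G) :=
  [set w | exists N, forall n, (N <= n)%N -> tree S F K y (w n)].

Lemma invariant_tree_event K y : invariant_event (tree_event K y).
Proof.
split.
  have -> : tree_event K y = \bigcup_N \bigcap_(n in [set n | (N <= n)%N])
      [set w : Paths G | tree S F K y (w n)].
    by apply/seteqP; split=> w [N]; [move=> h; exists N|move=> _ h; exists N].
  apply: bigcupT_measurable => N; apply: bigcap_measurableType => n _.
  exact: measurable_coord.
apply/seteqP; split=> w [N h]; exists N.+1 => n Nn.
  by case: n Nn => // n Nn; exact: h.
by apply: h; rewrite ltnW// ltnS ltnW.
Qed.

Lemma tree_event_disjoint K y y' : y \in F K -> y' \in F K -> y <> y' ->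
  tree_event K y `&` tree_event K y' = set0.
Proof.
move=> yF yF' yy'; apply/seteqP; split=> // w [[N hN] [M hM]].
apply: (tree_disjoint ss yF yF' yy' (hN (maxn N M) _) (hM (maxn N M) _)).
  exact: leq_maxl.
exact: leq_maxr.
Qed.

Lemma gact_imageE (g : G) (B : set (Paths G)) :
  gact g @` B = gact (ginv g) @^-1` B.
Proof.
have E h (w : Paths G) : gact h (gact (ginv h) w) = w.
  by apply: funext => i; rewrite /gact gKV.
apply/seteqP; split=> [_ [w Bw <-]|w Bw]; last by exists (gact (ginv g) w).
by rewrite /preimage /=; have := E (ginv g) w; rewrite ginvK => ->.
Qed.

(** Almost every [w] in [A] eventually stays in the tree of some [y], while its translate by g^-1
    stays in the tree of g^-1 [y]. There are countably many pairs ([K], [y]), so one of the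
    resulting events has positive probability. If [w] and g^-1 [w] both lie in it, then g^-1 [w]
    stays in the trees of [y] and of g^-1 [y], which are disjoint. *)
Lemma step_ess_free : ess_free_boundary nu.
Proof.
move=> P Plaw g g1 A iA PA0; have [mA _] := iA.
(* Large enough for [eventually_tree] to apply to the identity and to g^-1 with the same [K] and
   [y]. *)
pose a := (pickle (ginv g) + pickle (gone : G)).+1.
pose B (Ky : nat * G) := if (Ky.2 \in F Ky.1) && (gmul (ginv g) Ky.2 \in F Ky.1) then
   A `&` (tree_event Ky.1 Ky.2 `&`
     gact (ginv g) @^-1` tree_event Ky.1 (gmul (ginv g) Ky.2)) else set0.
have iB Ky : invariant_event (B Ky).
  rewrite /B; case: ifP => _; last by split.
  have [m1 i1] := invariant_tree_event Ky.1 Ky.2.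
  have [m2 i2] := invariant_gact (ginv g)
    (invariant_tree_event Ky.1 (gmul (ginv g) Ky.2)).
  split; first exact: measurableI mA (measurableI _ _ m1 m2).
  by rewrite !preimage_setI i1 i2 (iA.2).
have cover : A `<=` lim_sup_set (atypical S) `|` \bigcup_Ky B Ky.
  move=> w Aw; have [|nl] := pselect (lim_sup_set (atypical S) w); first by left.
  right; have [T typ] : exists T, forall t, (T <= t)%N -> ~ atypical S t w.
    apply: contrapT => h; apply: nl => n _; apply: contrapT => h'; apply: h.
    by exists n => t nt hw; apply: h'; exists t.
  have rec := typical_record ss (leq_maxl T a) typ.
  have [K [y Ky]] := eventually_tree ss rec.
  have [|yF yT] := Ky gone; first by rewrite leq_max ltnS leq_addl orbT.
  have [|gyF gyT] := Ky (ginv g); first by rewrite leq_max ltnS leq_addr orbT.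
  exists (K, y) => //; rewrite /B /=; rewrite gmul1 in yF yT.
  rewrite yF gyF; split=> //; split; exists (len (maxn T a)) => n nN.
    by have := yT n nN; rewrite gmul1.
  exact: gyT.
have [Ky BKy] : exists Ky, P (B Ky) <> 0%E.
  apply: contrapT => h; move: PA0; rewrite (_ : P A = 0%E) ?ltxx//.
  pose E (o : option (nat * G)) :=
    if o is Some Ky then B Ky else lim_sup_set (atypical S).
  apply: (@null_cover _ _ _ P (option (nat * G)) A E) => //.
  - move=> [Ky|] /=; first by case: (iB Ky).
    apply: bigcap_measurableType => n _; apply: bigcup_measurable => t _.
    by case: (atypical_rare ss Plaw t).
  - move=> [Ky|] /=; last exact: (atypical_finitely_often ss Plaw).
    by apply: contrapT => h'; apply: h; exists Ky.
  - by move=> w /cover[h'|[Ky _ h']]; [exists None|exists (Some Ky)].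
exists (B Ky); split=> //.
- by rewrite /B; case: ifP => // _ w [].
- by rewrite lt0e measure_ge0 andbT; apply/eqP.
rewrite gact_imageE (_ : _ `&` _ = set0) ?measure0//.
apply/seteqP; split=> // w [].
rewrite /B; case: ifP => // /andP[yF gyF] [_ [_ w1]] [_ [w2 _]].
have yy : Ky.2 <> gmul (ginv g) Ky.2.
  move=> e; apply: g1; apply: (@gmulIr _ Ky.2).
  by rewrite {1}e gKV gmul1.
have : (tree_event Ky.1 Ky.2 `&` tree_event Ky.1 (gmul (ginv g) Ky.2))
    (gact (ginv g) w) by split.
by rewrite tree_event_disjoint.
Qed.
End TreeEvent.

(* In a trivial boundary every non-null event [B] has full measure, and so has
   [g B] because [nu] charges [g^-1]. *)
Lemma free_nontrivial (R : realType) (G : cgroup) (nu : G -> R) :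
  nontrivial_group G -> is_prob nu -> full_support nu ->
  ess_free_boundary nu -> poisson_nontrivial nu.
Proof.
move=> [g g1] [nu0 nu1] nufull free P Plaw triv.
have [||B [iB _ PB0 BgB]] := free P Plaw g g1 setT.
- by split; [exact: measurableT|exact: preimage_setT].
- by rewrite probability_setT lte01.
have PB : P B = 1%E by case: (triv B iB) => // PB; move: PB0; rewrite PB ltxx.
pose h x := P (gact (G := G) x @^-1` B).
have mh x : measurable (gact (G := G) x @^-1` B) by apply: measurable_gact_pre; case: iB.
have h01 x : h x = 0%E \/ h x = 1%E by apply: triv; exact: invariant_gact.
have [hg|hg] := h01 (ginv g); last first.
  move: BgB; rewrite gact_imageE => BgB.
  have mB : measurable B by case: iB.
  have : (P B <= P (B `&` gact (ginv g) @^-1` B) + P (~` (gact (ginv g) @^-1` B)))%E.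
    apply: le_trans (measureU2 _ _ _); first apply: le_measure; rewrite ?inE//.
    - apply: measurableU; [exact: measurableI|exact: measurableC].
    - move=> w Bw; have [|] := pselect ((gact (ginv g) @^-1` B) w); first by left.
      by right.
    - exact: measurableI.
    - exact: measurableC.
  by rewrite BgB add0e probability_setC// -/(h _) hg subee// PB lee_fin ler10.
have : (P B + (nu (ginv g))%:E <= 1%:E)%E.
  rewrite -(gact_pre1 B) (harmonic_invariant Plaw)// -nu1.
  have -> : (nu (ginv g))%:E = (\esum_(x in [set: G])
      (if x \in [set ginv g] then (nu x)%:E else 0))%E.
    by rewrite -esum_mkcond esum_set1// lee_fin.
  rewrite -esumD; first last.
  - by move=> x _; case: ifP => // _; rewrite lee_fin.
  - by move=> x _; rewrite mule_ge0 ?lee_fin.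
  apply: le_esum => x _; rewrite gmul1 -/(h x).
  case: ifPn => [|_]; first by rewrite inE => ->; rewrite hg mule0 add0e.
  by rewrite adde0; case: (h01 x) => ->; rewrite ?mule0 ?mule1 ?lee_fin.
by rewrite PB -EFinD lee_fin gerDl leNgt nufull.
Qed.
Lemma coordinate_fun_left (R : realType) (G1 G2 : cgroup)
    (y : prod_cgroup G1 G2) (H : prod_cgroup G1 G2 -> R) :
  coordinate_fun H -> coordinate_fun (fun x => H (gmul y x)).
Proof.
case=> -[f Hf]; [left; exists (fun a => f (gmul y.1 a))|
  right; exists (fun b => f (gmul y.2 b))] => x; by rewrite Hf.
Qed.
End Freeness.

Theorem theoremA (R : realType) (G1 G2 : cgroup) :
  nontrivial_group G1 -> nontrivial_group G2 ->
  amenable G1 -> amenable G2 ->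
  ICC G1 -> ICC G2 ->
  exists nu : prod_cgroup G1 G2 -> R,
    [/\ is_prob nu, full_support nu & symmetric_measure nu] /\
    [/\ poisson_nontrivial nu, ess_free_boundary nu,
        poisson_trivial (pr1_meas nu) & poisson_trivial (pr2_meas nu)].
Proof.
move=> nt1 nt2 am1 am2 icc1 icc2.
pose G := prod_cgroup G1 G2.
have [S [F ss]] := @switching_sequence_exists R G (@coordinate_fun R G1 G2)
  (fun t => (len t).+2) quality (fun t => expn_gt0 t.+2 4)
  (@switching_exists R G1 G2 nt1 nt2 am1 am2 icc1 icc2).
have [sw _ _ _ _] := ss.
have uS t : uniq (S t) by case: (sw t).
have S0 t : S t != [::] by case: (sw t).
have SV t s : s \in S t -> ginv s \in S t by case: (sw t) => _ _ + _ _; exact.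
have Sdisj t u s : s \in S t -> s \in S u -> t = u by exact: (letters_disjoint ss).
have pnu : is_prob (step R S) by exact: step_prob.
have fnu : full_support (step R S) by move=> x; exact: step_gt0.
have free : ess_free_boundary (step R S) by exact: step_ess_free ss.
have CL := @coordinate_fun_left R G1 G2.
exists (step R S); split; split=> //.
- by move=> x; rewrite /step weightV.
- apply: free_nontrivial => //; have [g g1] := nt1.
  by exists ((g, gone) : G) => -[].
- apply: (quotient_trivial ss CL (pi := fst)) => //.
  + by move=> a; exists (a, gone).
  + by move=> f; left; exists f.
  + exact: pr1_measE.
- apply: (quotient_trivial ss CL (pi := snd)) => //.
  + by move=> b; exists (gone, b).
  + by move=> f; right; exists f.
  + exact: pr2_measE.
Qed.
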